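(* Let $(R,\mathfrak m)$ be a Cohen-Macaulay local ring of dimension two with infinite residue field, let $I,J$ be $\mathfrak m$-primary ideals of $R$, and let $(a,b)$ be a Rees-joint reduction of $I$ and $J$. Then the following statements are equivalent: (a) $\ell_R([H^2_{(at_1,bt_2)}(\mathcal R')]_{(0,0)})<\infty$; (b) $e_{(1,0)}=e_1(I)$ and $e_{(0,1)}=e_1(J)$; (c) $M^1_{i,*}=0$ for all $i\ge0$ and $M^1_{*,j}=0$ for all $j\ge0$. If any of these equivalent conditions holds, then $$\ell_R([H^2_{(at_1,bt_2)}(\mathcal R')]_{(0,0)})=-e_2(IJ)+e_2(I)+e_2(J).$$
   Context: $\ell=\ell_R$ denotes length of $R$-modules. $I^n=J^n=R$ for $n\le0$. A pair $(a,b)$ is a joint reduction of $I$ and $J$ if $a\in I$, $b\in J$ and $I^{r+1}J^{s+1}=aI^rJ^{s+1}+bI^{r+1}J^s$ for all large $r,s$. It is a Rees-joint reduction if moreover $(a)\cap I^rJ^s=aI^{r-1}J^s$ for $r\gg0$ and all $s\ge0$, and $(b)\cap I^rJ^s=bI^rJ^{s-1}$ for $s\gg0$ and all $r\ge0$. $\mathcal R'=\bigoplus_{r,s\in\mathbb Z}I^rJ^st_1^rt_2^s\subseteq R[t_1^{\pm1},t_2^{\pm1}]$ is the bigraded extended Rees algebra; $H^2_{(at_1,bt_2)}(\mathcal R')$ is its second local cohomology module with support in the ideal $(at_1,bt_2)$, and $[\,\cdot\,]_{(r,s)}$ is the bigraded component. For $r,s\ge0$: $M^1_{r,s}:=\dfrac{I^{r+1}J^{s+1}}{aI^rJ^{s+1}+bI^{r+1}J^s}$.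 For fixed $i$, $\ell(M^1_{i,s})$ is independent of $s$ for $s\gg0$; this number is denoted $M^1_{i,*}$. For fixed $j$, $\ell(M^1_{r,j})$ is independent of $r$ for $r\gg0$; this number is denoted $M^1_{*,j}$. Hilbert coefficients: for an $\mathfrak m$-primary ideal $K$, $\ell(R/K^n)=e_0(K)\binom{n+1}{2}-e_1(K)n+e_2(K)$ for $n\gg0$. Bigraded Hilbert coefficients $e_{(i,j)}$ of $\{I^rJ^s\}$: $\ell(R/I^rJ^s)=\sum_{i+j\le 2}(-1)^{i+j}e_{(i,j)}\binom{r+i-1}{i}\binom{s+j-1}{j}$ for all $r,s\gg0$. *)

(* Defs.v *)
From HB Require Import structures.
From mathcomp Require Import all_boot all_order all_algebra.
From mathcomp Require Import finmap generic_quotient.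
From mathcomp.multinomials Require Import monalg.
From mathcomp Require Import zify.
From mathcomp Require Import boolp classical_sets cardinality constructive_ereal.

Set Implicit Arguments.
Unset Strict Implicit.
Unset Printing Implicit Defensive.

Import Order.TTheory GRing.Theory Num.Theory.

Local Open Scope classical_set_scope.
Local Open Scope ring_scope.

Section Length.
Context {R : comNzRingType} {V : lmodType R}.
Implicit Types A B N : set V.

Definition submod N :=
  N 0 /\ forall (c : R) u v, N u -> N v -> N (c *: u + v).

Definition set_add A B : set V := [set x + y | x in A & y in B].

(* The submodules of B / A are the N / A with A <= N <= B, so this is a chain
   N_0 < ... < N_n of submodules of B / A. *)
Definition has_chain B A (n : nat) :=
  exists N : nat -> set V,
    (forall i, (i <= n)%N -> [/\ submod (N i), A `<=` N i & N i `<=` B]) /\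
    (forall i, (i < n)%N -> N i `<` N i.+1).

(* The length of the R-module B / A, for submodules A <= B of V. *)
Definition length B A : \bar int :=
  xget +oo%E [set n%:Z%:E | n in [set n | has_chain B A n /\
                                          ~ has_chain B A n.+1]].

End Length.

Section Ideals.
Context {R : comNzRingType}.
Implicit Types (I J K P m : set R) (a b x : R).

Definition ideal I := submod (I : set R^o).

Definition ideal_gen (G : set R) : set R := smallest ideal G.

Definition ideal_mul I J : set R := ideal_gen [set x * y | x in I & y in J].

Definition ideal_exp I (n : nat) : set R := iter n (ideal_mul I) setT.

Definition ideal_expz I (n : int) : set R :=
  if n is Posz k then ideal_exp I k else setT.

Definition ideal_exp2 I J (r s : int) : set R :=
  ideal_mul (ideal_expz I r) (ideal_expz J s).

Definition elt_mul a I : set R := [set a * x | x in I].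

Definition ideal_add I J : set R := set_add (I : set R^o) (J : set R^o).

Definition prime_ideal P :=
  [/\ ideal P, ~ P 1 & forall x y, P (x * y) -> P x \/ P y].

Definition primary_ideal I :=
  [/\ ideal I, ~ I 1 & forall x y, I (x * y) -> I x \/ exists n, I (y ^+ n)].

Definition radical I : set R := [set x | exists n, I (x ^+ n)].

Definition maximal_ideal m :=
  [/\ ideal m, ~ m 1 & forall I, ideal I -> ~ I 1 -> m `<=` I -> I = m].

Definition local_ring m :=
  maximal_ideal m /\ forall m', maximal_ideal m' -> m' = m.

Definition noetherian :=
  forall I, ideal I -> exists s : seq R, I = ideal_gen [set` s].

Definition m_primary m I := primary_ideal I /\ radical I = m.

Definition has_prime_chain (n : nat) :=
  exists P : nat -> set R,
    (forall i, (i <= n)%N -> prime_ideal (P i)) /\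
    (forall i, (i < n)%N -> P i `<` P i.+1).

Definition krull_dim (d : nat) := has_prime_chain d /\ ~ has_prime_chain d.+1.

Definition regular_seq (s : seq R) :=
  ~ ideal_gen [set` s] 1 /\
  forall i, (i < size s)%N -> forall x,
    ideal_gen [set` take i s] (s`_i * x) -> ideal_gen [set` take i s] x.

Definition depth m (d : nat) :=
  (exists s : seq R, [/\ regular_seq s, [set` s] `<=` m & size s = d]) /\
  (forall s : seq R, regular_seq s -> [set` s] `<=` m -> (size s <= d)%N).

Definition cohen_macaulay m := exists2 d, depth m d & krull_dim d.

(* The set of cosets of m is the residue field R / m. *)
Definition infinite_residue_field m :=
  infinite_set (range (fun x => [set y | m (y - x)])).

Definition colength K : \bar int := length (setT : set R^o) K.

(* e_i(K), for i <= 2 (the values at i > 2 are meaningless). *)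
Definition hilbert_coef K : nat -> int :=
  xget (fun=> 0) [set e : nat -> int |
    exists N : nat, forall n : nat, (N <= n)%N ->
      colength (ideal_exp K n) =
      (e 0%N * 'C(n.+1, 2)%:Z - e 1%N * n%:Z + e 2%N)%:E].

(* e_(i,j) of the filtration {I^r J^s}, for i + j <= 2. *)
Definition bihilbert_coef I J : nat -> nat -> int :=
  xget (fun=> fun=> 0) [set e : nat -> nat -> int |
    exists N : nat, forall r s : nat, (N <= r)%N -> (N <= s)%N ->
      colength (ideal_exp2 I J r s) =
      (\sum_(i < 3) \sum_(j < 3 | (i + j <= 2)%N)
         (-1) ^+ (i + j) * e i j
         * 'C((r + i).-1, i)%:Z * 'C((s + j).-1, j)%:Z)%:E].

Definition joint_reduction I J a b :=
  [/\ I a, J b & exists N : nat, forall r s : nat, (N <= r)%N -> (N <= s)%N ->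
    ideal_exp2 I J (r%:Z + 1) (s%:Z + 1) =
    ideal_add (elt_mul a (ideal_exp2 I J r%:Z (s%:Z + 1)))
              (elt_mul b (ideal_exp2 I J (r%:Z + 1) s%:Z))].

Definition rees_joint_reduction I J a b :=
  [/\ joint_reduction I J a b,
      exists N : nat, forall r s : nat, (N <= r)%N ->
        elt_mul a setT `&` ideal_exp2 I J r%:Z s%:Z =
        elt_mul a (ideal_exp2 I J (r%:Z - 1) s%:Z) &
      exists N : nat, forall r s : nat, (N <= s)%N ->
        elt_mul b setT `&` ideal_exp2 I J r%:Z s%:Z =
        elt_mul b (ideal_exp2 I J r%:Z (s%:Z - 1))].

Definition length_M1 I J a b (r s : nat) : \bar int :=
  length (ideal_exp2 I J (r%:Z + 1) (s%:Z + 1) : set R^o)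
    (ideal_add (elt_mul a (ideal_exp2 I J r%:Z (s%:Z + 1)))
               (elt_mul b (ideal_exp2 I J (r%:Z + 1) s%:Z))).

End Ideals.

Arguments noetherian : clear implicits.
Arguments krull_dim : clear implicits.

(* The constant value of u n for large n (and +oo if u is not eventually
   constant). *)
Definition eventual_value (u : nat -> \bar int) : \bar int :=
  xget +oo%E [set l | exists N : nat, forall n : nat, (N <= n)%N -> u n = l].

Definition M1_row (R : comNzRingType) (I J : set R) a b (i : nat) :=
  eventual_value (fun s => length_M1 I J a b i s).
Definition M1_col (R : comNzRingType) (I J : set R) a b (j : nat) :=
  eventual_value (fun r => length_M1 I J a b r j).

(* monalg only makes {malg R[K]} a ring for conical monoids K, which excludes
   Z^2: the module structure comes from monalg, the product is defined here. *)
Definition laurent (R : comNzRingType) := {malg R[(int * int)%type]}.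

(* c t1^d.1 t2^d.2 *)
Definition lmonom {R : comNzRingType} (c : R) (d : int * int) : laurent R :=
  mkmalgU d c.

Section LaurentRing.
Context (R : comNzRingType).
Implicit Types (f g h : laurent R) (c : R) (d : int * int).

HB.instance Definition _ := GRing.Lmodule.on (laurent R).

Definition lmul f g : laurent R :=
  \sum_(d <- msupp f) \sum_(d' <- msupp g)
    lmonom (mcoeff d f * mcoeff d' g) (d + d').

Lemma lmonom0 d : lmonom 0 d = 0 :> laurent R.
Proof. exact: monalgU0. Qed.

Lemma lmulw (D D' : {fset (int * int)}) f g :
  (msupp f `<=` D)%fset -> (msupp g `<=` D')%fset ->
  lmul f g = \sum_(d <- D) \sum_(d' <- D')
               lmonom (mcoeff d f * mcoeff d' g) (d + d').
Proof.
move=> le_D le_D'; rewrite /lmul (big_fset_incl _ le_D) /=.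
  apply/eq_bigr=> d _; apply/big_fset_incl => // d' _ /mcoeff_outdom ->.
  by rewrite mulr0 lmonom0.
move=> d _ /mcoeff_outdom fd.
by rewrite big1 // => d' _; rewrite fd mul0r lmonom0.
Qed.

Lemma lmulC : commutative lmul.
Proof.
move=> f g; rewrite /lmul exchange_big /=; apply/eq_bigr => d _.
by apply/eq_bigr => d' _; rewrite mulrC addrC.
Qed.

Lemma lmulDl : left_distributive lmul +%R.
Proof.
move=> f g h.
have le_h := fsubset_refl (msupp h).
rewrite (lmulw (msuppD_le f g) le_h).
rewrite (lmulw (fsubsetUl _ (msupp g)) le_h).
rewrite (lmulw (fsubsetUr (msupp f) _) le_h) -big_split /=.
apply/eq_bigr => d _; rewrite -big_split /=; apply/eq_bigr => d' _.
by rewrite mcoeffD mulrDl; apply: monalgUD.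
Qed.

Lemma lmulDr : right_distributive lmul +%R.
Proof. by move=> f g h; rewrite lmulC lmulDl !(lmulC f). Qed.

Lemma lmul0l : left_zero 0 lmul.
Proof. by move=> f; rewrite /lmul msupp0 big_seq_fset0. Qed.

Lemma lmul0r : right_zero 0 lmul.
Proof. by move=> f; rewrite lmulC lmul0l. Qed.

Lemma lmonomM c c' d d' :
  lmul (lmonom c d) (lmonom c' d') = lmonom (c * c') (d + d').
Proof. by rewrite (lmulw msuppU_le msuppU_le) !big_seq_fset1 !mcoeffUU. Qed.

Lemma laurentE f : f = \sum_(d <- msupp f) lmonom (mcoeff d f) d.
Proof. exact: monalgE. Qed.

Lemma lmul_suml (s : seq (int * int)) (F : int * int -> laurent R) g :
  lmul (\sum_(d <- s) F d) g = \sum_(d <- s) lmul (F d) g.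
Proof.
exact: (big_morph (lmul^~ g) (fun f f' => lmulDl f f' g) (lmul0l g)).
Qed.

Lemma lmul_sumr (s : seq (int * int)) (F : int * int -> laurent R) g :
  lmul g (\sum_(d <- s) F d) = \sum_(d <- s) lmul g (F d).
Proof. exact: (big_morph (lmul g) (lmulDr g) (lmul0r g)). Qed.

Lemma lmulA : associative lmul.
Proof.
move=> f g h; rewrite [f]laurentE.
rewrite (lmul_suml _ _ (lmul g h)) (lmul_suml _ _ g) (lmul_suml _ _ h).
apply: eq_bigr => d _; move: (mcoeff d f) => {f} c; rewrite [g]laurentE.
rewrite (lmul_suml _ _ h) !(lmul_sumr _ _ (lmonom c d)) (lmul_suml _ _ h).
apply: eq_bigr => d' _; move: (mcoeff d' g) => {g} c'; rewrite [h]laurentE.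
rewrite (lmul_sumr _ _ (lmonom c' d')) (lmul_sumr _ _ (lmul _ _)).
rewrite (lmul_sumr _ _ (lmonom c d)); apply: eq_bigr => d'' _.
by rewrite !lmonomM mulrA addrA.
Qed.

Definition lone : laurent R := lmonom 1 0.

Lemma lmul1 : left_id lone lmul.
Proof.
move=> f; rewrite [f]laurentE lmul_sumr; apply/eq_bigr => d _.
by rewrite lmonomM mul1r add0r.
Qed.

Lemma lone_neq0 : lone != 0.
Proof. by rewrite monalgU_eq0 oner_eq0. Qed.

HB.instance Definition _ := GRing.Zmodule_isComNzRing.Build (laurent R)
  lmulA lmulC lmul1 lmulDl lone_neq0.

Lemma lscaleAl c f g : c *: (f * g) = (c *: f) * g.
Proof.
have scaleE h : c *: h = lmonom c 0 * h.
  rewrite [RHS](lmulw msuppU_le (fsubset_refl _)) big_seq_fset1.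
  rewrite {1}(laurentE h) scaler_sumr; apply/eq_bigr => d _.
  by rewrite mcoeffUU add0r; apply/malgP => e; rewrite mcoeffZ !mcoeffU mulrnAr.
by rewrite !scaleE mulrA.
Qed.

HB.instance Definition _ :=
  GRing.Lmodule_isLalgebra.Build R (laurent R) lscaleAl.
HB.instance Definition _ := GRing.Lalgebra_isComAlgebra.Build R (laurent R).

End LaurentRing.

Section Localization.
Context {R : comNzRingType} {S : comAlgType R} (x : S).

(* (u, k) stands for u / x^k *)
Definition loc_equiv (p q : S * nat) : bool :=
  `[< exists n, x ^+ (n + q.2) * p.1 = x ^+ (n + p.2) * q.1 >].

Lemma loc_equivP : equiv_class_of loc_equiv.
Proof.
split=> [p | p q | q p r].
- by apply/asboolP; exists 0%N.
- by apply/asboolP/asboolP => -[n e]; exists n.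
move=> /asboolP[n e] /asboolP[n' e']; apply/asboolP.
exists (n + n' + q.2)%N.
transitivity (x ^+ (n' + r.2) * (x ^+ (n + q.2) * p.1)).
  by rewrite mulrA -exprD; congr (x ^+ _ * _); lia.
rewrite e mulrCA e' mulrA -exprD; congr (x ^+ _ * _); lia.
Qed.

Canonical loc_equiv_rel := EquivRelPack loc_equivP.

Definition loc := {eq_quot loc_equiv}%qT.

Definition frac (u : S) (k : nat) : loc := \pi_loc%qT (u, k).

HB.instance Definition _ := Choice.on loc.

Lemma fracP (z : loc) : exists u k, z = frac u k.
Proof.
exists (repr z).1, (repr z).2.
by rewrite /frac -surjective_pairing reprK.
Qed.

Lemma eq_frac u v k l :
  frac u k = frac v l <-> exists n, x ^+ (n + l) * u = x ^+ (n + k) * v.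
Proof.
rewrite /frac; split=> [/eqmodP/asboolP[n /= e]|[n e]]; first by exists n.
by apply/eqmodP/asboolP; exists n.
Qed.

Lemma frac_expand j u k : frac (x ^+ j * u) (j + k) = frac u k.
Proof.
by apply/eq_frac; exists 0%N; rewrite mulrA -exprD; congr (x ^+ _ * _); lia.
Qed.

Definition loc_add (z w : loc) : loc :=
  let p := repr z in let q := repr w in
  frac (x ^+ q.2 * p.1 + x ^+ p.2 * q.1) (p.2 + q.2).

Definition loc_opp (z : loc) : loc := frac (- (repr z).1) (repr z).2.

Definition loc_scale (c : R) (z : loc) : loc :=
  frac (c *: (repr z).1) (repr z).2.

Lemma repr_frac u k : exists n,
  x ^+ (n + k) * (repr (frac u k)).1 = x ^+ (n + (repr (frac u k)).2) * u.
Proof.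
by apply/eq_frac; rewrite /frac -surjective_pairing reprK.
Qed.

Lemma loc_addE u v k :
  loc_add (frac u k) (frac v k) = frac (u + v) k.
Proof.
rewrite /loc_add; have [n e] := repr_frac u k; have [n' e'] := repr_frac v k.
move: (repr (frac u k)) (repr (frac v k)) e e' => [u' i] [v' j] /= e e'.
apply/eq_frac; exists (n + n')%N; rewrite !mulrDr.
congr (_ + _); rewrite mulrA -exprD.
  transitivity (x ^+ (n' + j) * (x ^+ (n + k) * u')).
    by rewrite mulrA -exprD; congr (x ^+ _ * _); lia.
  by rewrite e mulrA -exprD; congr (x ^+ _ * _); lia.
transitivity (x ^+ (n + i) * (x ^+ (n' + k) * v')).
  by rewrite mulrA -exprD; congr (x ^+ _ * _); lia.
by rewrite e' mulrA -exprD; congr (x ^+ _ * _); lia.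
Qed.

Lemma loc_oppE u k : loc_opp (frac u k) = frac (- u) k.
Proof.
rewrite /loc_opp; have [n e] := repr_frac u k.
by apply/eq_frac; exists n; rewrite !mulrN e.
Qed.

Lemma loc_scaleE c u k : loc_scale c (frac u k) = frac (c *: u) k.
Proof.
rewrite /loc_scale; have [n e] := repr_frac u k.
by apply/eq_frac; exists n; rewrite -!scalerAr e.
Qed.

Lemma loc_common (z w : loc) : exists u v k, z = frac u k /\ w = frac v k.
Proof.
have [[u [i ->]] [v [j ->]]] := (fracP z, fracP w).
exists (x ^+ j * u), (x ^+ i * v), (j + i)%N.
by rewrite frac_expand addnC frac_expand.
Qed.

Lemma loc_addC : commutative loc_add.
Proof.
move=> z w; have [u [v [k [-> ->]]]] := loc_common z w.
by rewrite !loc_addE addrC.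
Qed.

Lemma loc_addA : associative loc_add.
Proof.
move=> z w t; have [u [v [k [-> ->]]]] := loc_common z w.
have [w' [l ->]] := fracP t.
rewrite -(frac_expand l u) -(frac_expand l v) -(frac_expand k w') (addnC k).
by rewrite !loc_addE addrA.
Qed.

Lemma loc_add0 : left_id (frac 0 0) loc_add.
Proof.
move=> z; have [u [k ->]] := fracP z.
by rewrite -(frac_expand k 0) mulr0 addn0 loc_addE add0r.
Qed.

Lemma loc_addN : left_inverse (frac 0 0) loc_opp loc_add.
Proof.
move=> z; have [u [k ->]] := fracP z.
by rewrite loc_oppE loc_addE addNr -[in RHS](frac_expand k 0) mulr0 addn0.
Qed.

HB.instance Definition _ :=
  GRing.isZmodule.Build loc loc_addA loc_addC loc_add0 loc_addN.

Lemma loc_scaleA c c' z : loc_scale c (loc_scale c' z) = loc_scale (c * c') z.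
Proof. by have [u [k ->]] := fracP z; rewrite !loc_scaleE scalerA. Qed.

Lemma loc_scale1 : left_id 1 loc_scale.
Proof. by move=> z; have [u [k ->]] := fracP z; rewrite loc_scaleE scale1r. Qed.

Lemma loc_scaleDr : right_distributive loc_scale +%R.
Proof.
move=> c z w; have [u [v [k [-> ->]]]] := loc_common z w.
by rewrite [_ + _]loc_addE !loc_scaleE [RHS]loc_addE scalerDr.
Qed.

Lemma loc_scaleDl z : {morph loc_scale^~ z : c c' / c + c'}.
Proof.
move=> c c'; have [u [k ->]] := fracP z.
by rewrite !loc_scaleE [RHS]loc_addE scalerDl.
Qed.

HB.instance Definition _ := GRing.Zmodule_isLmodule.Build R loc
  loc_scaleA loc_scale1 loc_scaleDr loc_scaleDl.

End Localization.

Arguments loc {R S} x.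

Section LocalCohomology.
Context {R : comNzRingType} {L : comAlgType R}.
Implicit Types (S : set L) (x y : L).

(* For x, y \in S, H^2_(x,y)(S) is the cokernel of the last map
     S_x (+) S_y -> S_(xy)
   of the Cech complex of S on x, y.  Since localization is exact, S_(xy) is
   taken inside L_(xy), as the set of the fractions u / (xy)^k with u \in S,
   and [cech2_bound S x y] is the image of S_x (+) S_y:
     u / x^k = (y^k u) / (xy)^k  and  v / y^l = (x^l v) / (xy)^l. *)
Definition cech2_bound S x y : set (loc (x * y)) :=
  set_add [set frac (x * y) (y ^+ k * u) k | u in S & k in [set: nat]]
          [set frac (x * y) (x ^+ l * v) l | v in S & l in [set: nat]].

End LocalCohomology.

Arguments cech2_bound {R L} S x y _.

Section ExtendedRees.
Context {R : comNzRingType}.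
Implicit Types (I J : set R) (a b : R).

Definition ext_rees I J : set (laurent R) :=
  [set f | forall r s : int, ideal_exp2 I J r s (mcoeff (r, s) f)].

(* [R'_(xy)]_d for x = a t1 and y = b t2: the fractions u / (xy)^k with u \in R'
   homogeneous of degree d + k (1, 1). *)
Definition cech2_comp I J a b (d : int * int) :
    set (loc (lmonom a (1, 0) * lmonom b (0, 1))) :=
  [set z | exists c (k : nat),
     let e := (d.1 + k%:Z, d.2 + k%:Z) in
     ext_rees I J (lmonom c e) /\ z = frac _ (lmonom c e) k].

#[local] Arguments cech2_comp I J a b d _ : clear implicits.

(* The length of [H^2_(a t1, b t2)(R')]_d, that is, of the image (B + C) / B of
   C = [R'_(xy)]_d in R'_(xy) / B, with B the image of R'_x (+) R'_y. *)
Definition length_H2 I J a b (d : int * int) : \bar int :=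
  let B := cech2_bound (ext_rees I J) (lmonom a (1, 0)) (lmonom b (0, 1)) in
  length (set_add B (cech2_comp I J a b d)) B.

End ExtendedRees.

(* Main.v *)
Require Import Defs.
From mathcomp Require Import all_boot all_order all_algebra.
From mathcomp.multinomials Require Import monalg.
From mathcomp Require Import boolp classical_sets cardinality constructive_ereal.
From mathcomp Require Import zify ring.

(** Write e = l(R/(a,b)), V(r,s) = l(R/I^r J^s) and
      G(r,s) = rs e + V(r,0) + V(0,s) - V(r,s).
    Every pair generating an ideal that contains a power of m has an exact Koszul
    complex, so l(R/(pA + qB)) can be computed from l(R/A), l(R/B), l(R/(p,q))
    and l(R/((A : q) /\ (B : p))).  Applied to a^k, b^k, J^k, I^k this shows that
    I^k J^k / (a^k J^k + b^k I^k) has length G(k,k); for large k these modules form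
    an increasing chain of submodules with union [H^2]_(0,0), because multiplication
    by ab is injective on them by the Rees conditions.  Applied to a, b, I^r J^(s+1),
    I^(r+1) J^s it shows that l(M^1_(r,s)) is the mixed second difference of G at
    (r,s) as soon as r or s is large.

    Modulo a, the ideal I has a principal reduction y; hence r |-> V(r,s) has for
    large r the constant second difference l(R/(a,y)), independent of s.  So V is,
    for large r and s, a quadratic polynomial with the same r^2- and s^2-terms as
    V(r,0) and V(0,s), and G(r,s) is the affine function
      (e_(1,0) - e_1(I)) r + (e_(0,1) - e_1(J)) s + e_2(I) + e_2(J) - e_2(IJ).
    As G vanishes on the axes, summing l(M^1_(i,s)) over i < r expresses
    e_(0,1) - e_1(J) as the sum of the l(M^1_(i,s)), i < N, for every large s, and
    likewise for e_(1,0) - e_1(I).  In particular these slopes are nonnegative,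
    they vanish if and only if (c) holds, and if and only if G is bounded on the
    diagonal. *)

Set Implicit Arguments.
Unset Strict Implicit.
Unset Printing Implicit Defensive.

Import Order.TTheory GRing.Theory Num.Theory.
Local Open Scope classical_set_scope.
Local Open Scope ring_scope.

(** * Length *)

Section Submodules.
Context {R : comNzRingType} {V : lmodType R}.
Implicit Types A B C N M : set V.

Lemma submodD N u v : submod N -> N u -> N v -> N (u + v).
Proof. by move=> [_ h] Nu Nv; rewrite -[u]scale1r; apply: h. Qed.

Lemma submodZ N (c : R) u : submod N -> N u -> N (c *: u).
Proof. by move=> [N0 h] Nu; rewrite -[_ *: _]addr0; apply: h. Qed.

Lemma submodN N u : submod N -> N u -> N (- u).
Proof. by move=> sN Nu; rewrite -scaleN1r; apply: submodZ. Qed.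

Lemma submodB N u v : submod N -> N u -> N v -> N (u - v).
Proof. by move=> sN Nu Nv; apply: submodD => //; apply: submodN. Qed.

Lemma submod_setT : submod [set: V].
Proof. by []. Qed.

Lemma submod_setI N M : submod N -> submod M -> submod (N `&` M).
Proof.
move=> [N0 hN] [M0 hM]; split=> // c u v [? ?] [? ?].
by split; [apply: hN | apply: hM].
Qed.

Lemma submod_add N M : submod N -> submod M -> submod (set_add N M).
Proof.
move=> sN sM; split; first by exists 0; [apply: sN.1|exists 0; [apply: sM.1|rewrite addr0]].
move=> c _ _ [x Nx [y My <-]] [x' Nx' [y' My' <-]].
exists (c *: x + x'); first exact: sN.2.
exists (c *: y + y'); first exact: sM.2.
by rewrite scalerDr addrACA.
Qed.

Lemma sub_set_addl N M : submod M -> N `<=` set_add N M.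
Proof. by move=> [M0 _] x Nx; exists x => //; exists 0 => //; rewrite addr0. Qed.

Lemma sub_set_addr N M : submod N -> M `<=` set_add N M.
Proof. by move=> [N0 _] x Mx; exists 0 => //; exists x => //; rewrite add0r. Qed.

Lemma set_add_sub A B N : submod N -> A `<=` N -> B `<=` N -> set_add A B `<=` N.
Proof. by move=> sN hA hB _ [x /hA Nx [y /hB Ny <-]]; apply: submodD. Qed.

Lemma has_chain0 A B N : submod N -> A `<=` N -> N `<=` B -> has_chain B A 0.
Proof. by move=> sN AN NB; exists (fun=> N); split=> // i. Qed.

(** Removing the top term allows induction on the length of a chain while the upper end [B]
    varies. *)
Lemma has_chainS A B n : has_chain B A n.+1 <-> exists M N,
  [/\ submod M, submod N, M `<` N, N `<=` B & has_chain M A n].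
Proof.
split=> [[N [hN sN]]|[M [N [sM sN MN NB [K [hK sK]]]]]].
  exists (N n), (N n.+1); have [? ? ?] := hN n (leqnSn n); have [? ? ?] := hN _ (leqnn n.+1).
  split=> //; first exact: sN.
  have mono i j : (i <= j <= n)%N -> N i `<=` N j.
    move=> /andP[ij jn]; elim: j ij jn => [|j IH]; first by rewrite leqn0 => /eqP-> _ x.
    rewrite leq_eqVlt => /orP[/eqP-> _ x //|ij jn]; apply: subset_trans (IH _ _) _ => //.
      exact: ltnW.
    by apply: properW; apply: sN; apply: leqW.
  exists N; split=> i ile; last by apply: sN; apply: leqW.
  have [? ? ?] := hN i (leqW ile); split=> //; apply: mono; by rewrite ile /=.
exists (fun i => if (i <= n)%N then K i else N); split=> i ile.
  case: ifP => [ilen|_]; first by have [? ? KM] := hK i ilen; split=> //;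
    apply: subset_trans KM (subset_trans (properW MN) NB).
  split=> //; have [_ AK KM] := hK n (leqnn n); apply: subset_trans AK _.
  exact: subset_trans KM (properW MN).
rewrite ltnS in ile; rewrite ile; case: ifP => [|_]; first exact: sK.
have [_ _ KM] := hK i ile; case: MN => MN NM.
split=> [|NK]; first exact: subset_trans KM MN.
by apply: NM; apply: subset_trans NK KM.
Qed.

Lemma has_chain_sub A A' B B' n : A' `<=` A -> B `<=` B' ->
  has_chain B A n -> has_chain B' A' n.
Proof.
move=> AA BB [N [h s]]; exists N; split=> // i /h[? AN NB]; split=> //.
  exact: subset_trans AN.
exact: subset_trans NB BB.
Qed.

Lemma has_chain_pred A B n : has_chain B A n.+1 -> has_chain B A n.
Proof.
move=> /has_chainS[M [N [_ _ MN NB]]]; apply: has_chain_sub => //.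
exact: subset_trans (properW MN) NB.
Qed.

Lemma has_chain_le A B n k : (k <= n)%N -> has_chain B A n -> has_chain B A k.
Proof. by elim: n => [|n IH]; [rewrite leqn0 => /eqP->|
  rewrite leq_eqVlt => /orP[/eqP->//|kn] /has_chain_pred; apply: IH]. Qed.

Lemma has_chain_cat A B C p q :
  has_chain B C p -> has_chain C A q -> has_chain B A (p + q).
Proof.
move=> + hq; elim: p B => [|p IH] B.
  move=> [N [/(_ 0%N (leqnn _))[_ CN NB] _]].
  by apply: has_chain_sub hq => //; apply: subset_trans NB.
move=> /has_chainS[M [N [sM sN MN NB /IH hM]]]; rewrite addSn.
by apply/has_chainS; exists M, N.
Qed.

(** By the modular law, a strict step [M < N] stays strict after adding [C] or after intersecting
    with [C]. Each of the [n] steps therefore contributes to at least one of the two new chains. *)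
Lemma has_chain_split A B C n : submod C -> A `<=` C -> has_chain B A n ->
  exists p q, [/\ (n <= p + q)%N, has_chain (set_add B C) C p &
                  has_chain (B `&` C) A q].
Proof.
move=> sC AC; elim: n B => [|n IH] B.
  move=> [N [/(_ 0%N (leqnn _))[sN AN NB] _]].
  exists 0%N, 0%N; split=> //.
    apply: (has_chain0 sC) => // x Cx; exists 0; first exact/NB/sN.1.
    by exists x => //; rewrite add0r.
  apply: (has_chain0 (submod_setI sN sC)) => x.
    by move=> Ax; split; [apply: AN|apply: AC].
  by move=> [/NB].
move=> /has_chainS[M [N [sM sN MN NB /IH[p [q [npq hp hq]]]]]].
have addS X Y : X `<=` Y -> set_add X C `<=` set_add Y C.
  by move=> XY _ [x /XY Yx [y Cy <-]]; exists x => //; exists y.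
(* If [N] and [M] have the same intersection with [C], the step survives in the sums with [C];
   otherwise it survives in the intersections. *)
have [NC|NC] := pselect (N `&` C `<=` M).
  exists p.+1, q; split; first lia.
    apply/has_chainS; exists (set_add M C), (set_add N C).
    split=> //; [exact: submod_add|exact: submod_add| |exact: addS].
    split; first exact: addS (properW MN).
    move=> NM; case: MN => MN; apply=> x Nx.
    have [y My [c Cc yc]] := NM _ (sub_set_addl sC Nx).
    rewrite -yc; apply: submodD => //; apply: NC; split=> //.
    have -> : c = x - y by rewrite -yc addrC addKr.
    by apply: submodB => //; apply: MN.
  apply: has_chain_sub hq => // x [Mx Cx]; split=> //; exact/NB/MN.1.
exists p, q.+1; split; first lia.
  by apply: has_chain_sub hp => //; apply: addS; apply: subset_trans (properW MN) NB.
apply/has_chainS; exists (M `&` C), (N `&` C).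
split=> //; [exact: submod_setI|exact: submod_setI| |exact: setSI].
split; first exact: setSI (properW MN).
by move=> h; apply: NC => x /h[].
Qed.

Definition haslen B A n := has_chain B A n /\ ~ has_chain B A n.+1.

Lemma haslen_le A B n k : haslen B A n -> has_chain B A k -> (k <= n)%N.
Proof.
move=> [_ h] hk; rewrite leqNgt; apply/negP => nk; apply: h.
exact: has_chain_le hk.
Qed.

Lemma haslen_uniq A B n k : haslen B A n -> haslen B A k -> n = k.
Proof.
move=> hn hk; apply/eqP; rewrite eqn_leq (haslen_le hk hn.1).
by rewrite (haslen_le hn hk.1).
Qed.

Lemma haslenP A B n : haslen B A n <-> length B A = n%:Z%:E.
Proof.
split=> [hn|].
  rewrite /length; case: xgetP => [x _ [k hk <-]|/(_ n%:Z%:E) []].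
    by rewrite (haslen_uniq hn hk).
  by exists n.
rewrite /length; case: xgetP => [x _ [k hk <-] [<-]|//] //.
Qed.

Lemma length_fin A B : (length B A < +oo)%E <-> exists n, haslen B A n.
Proof.
split=> [|[n /haslenP->]]; last by rewrite ltry.
by rewrite {1}/length; case: xgetP => [x _ [k hk <-] _|]; [exists k|].
Qed.

(** Finiteness of a length is always reached through this lemma: it is enough to exclude chains with
    some fixed number of steps. *)
Lemma has_chain_bound A B k : submod A -> submod B -> A `<=` B ->
  ~ has_chain B A k -> exists2 n, (n < k)%N & haslen B A n.
Proof.
move=> sA sB AB; elim: k => [[]|k IH hk]; first exact: (has_chain0 sA).
have [h|/IH[n nk hn]] := pselect (has_chain B A k); first by exists k.
by exists n => //; apply: ltnW.
Qed.

Lemma set_add_id N M : submod N -> submod M -> M `<=` N -> set_add N M = N.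
Proof.
move=> sN sM MN; apply/seteqP; split; last exact: sub_set_addl.
exact: set_add_sub.
Qed.

Lemma haslenD A B C p q : submod B -> submod C -> A `<=` C -> C `<=` B ->
  haslen B C p -> haslen C A q -> haslen B A (p + q).
Proof.
move=> sB sC AC CB hp hq; split; first exact: has_chain_cat hp.1 hq.1.
move=> /(has_chain_split sC AC)[p' [q' [pq hp' hq']]].
rewrite set_add_id // in hp'.
rewrite setIC setIidl // in hq'.
have := haslen_le hq hq'; have := haslen_le hp hp'; lia.
Qed.

(** Chains of [C / A] and of [B / C] are chains of [B / A], so both lengths are finite, and
    additivity gives the sum. *)
Lemma haslen_cut A B C n : submod A -> submod B -> submod C ->
  A `<=` C -> C `<=` B -> haslen B A n ->
  exists p q, [/\ n = (p + q)%N, haslen B C p & haslen C A q].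
Proof.
move=> sA sB sC AC CB hn.
have [p _ hp] : exists2 p, (p < n.+1)%N & haslen B C p.
  apply: has_chain_bound => // h; apply: hn.2; exact: has_chain_sub h.
have [q _ hq] : exists2 q, (q < n.+1)%N & haslen C A q.
  apply: has_chain_bound => // h; apply: hn.2; exact: has_chain_sub h.
exists p, q; split=> //; exact: haslen_uniq hn (haslenD sB sC AC CB hp hq).
Qed.

Lemma haslen0 A B : submod A -> submod B -> A `<=` B -> haslen B A 0 <-> A = B.
Proof.
move=> sA sB AB; split=> [[_ h]|<-].
  apply/seteqP; split=> //; apply: contrapT => nBA; apply: h.
  apply/has_chainS; exists A, B; split=> //; exact: (has_chain0 sA).
split=> [|/has_chainS[M [N [_ _ MN NA [K [h _]]]]]]; first exact: (has_chain0 sA).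
have [_ AK KM] := h 0%N (leqnn _); case: MN => _; apply.
by apply: subset_trans NA (subset_trans AK KM).
Qed.

End Submodules.

(** * Transport of length along linear maps *)

Section LinearImage.
Context {R : comNzRingType} {V W : lmodType R} (f : V -> W).
Hypothesis f_lin : linear f.

Lemma lin0 : f 0 = 0.
Proof. by have := f_lin (-1) 0 0; rewrite !scaleN1r !addNr. Qed.

Lemma linB u v : f (u - v) = f u - f v.
Proof. by rewrite addrC -scaleN1r f_lin scaleN1r addrC. Qed.

Lemma submod_preim (N : set W) : submod N -> submod (f @^-1` N).
Proof.
move=> [N0 hN]; split=> [|c u v Nu Nv]; first by rewrite /preimage /= lin0.
by rewrite /preimage /= f_lin; apply: hN.
Qed.

Lemma submod_im (N : set V) : submod N -> submod (f @` N).
Proof.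
move=> [N0 hN]; split=> [|c _ _ [u Nu <-] [v Nv <-]].
  by exists 0 => //; rewrite lin0.
by exists (c *: u + v); [apply: hN|rewrite f_lin].
Qed.

Section LengthTransfer.
Variables (A B : set V) (A' B' : set W).
Hypotheses (sB : submod B) (sA' : submod A') (sB' : submod B').
Hypotheses (AB : A `<=` B) (AB' : A' `<=` B').
Hypothesis fB : forall v, B v -> B' (f v).
Hypothesis f_onto : forall w, B' w -> exists2 v, B v & A' (w - f v).
Hypothesis f_inj : forall v, B v -> A' (f v) <-> A v.

(** The hypotheses of this section say that [f] induces an isomorphism of [B / A] onto [B' / A'].
    Chains are pulled back here and pushed forward in the next lemma, so no quotient module is
    formed. *)
Lemma has_chain_preim n : has_chain B' A' n -> has_chain B A n.
Proof.
case=> N [h s]; exists (fun i => B `&` f @^-1` N i); split=> i ilt.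
  have [sN AN NB] := h i ilt; split=> [|v Av|v []//].
    exact: submod_setI (submod_preim sN).
  by split; [apply: AB|apply: AN; apply/f_inj => //; apply: AB].
have [sN AN NB] := h _ ilt; have [sN0 AN0 NB0] := h i (ltnW ilt).
have [NN nN] := s i ilt; split=> [v [Bv Nv]|ge]; first by split=> //; apply: NN.
apply: nN => w Nw; have [v Bv Av] := f_onto (NB _ Nw).
rewrite -[w](subrK (f v)); apply: submodD => //; first exact: AN0.
have [|//] := ge v; split=> //; rewrite /preimage /=.
by rewrite -[f v](subKr w); apply: submodB => //; apply: AN.
Qed.

Lemma has_chain_im n : has_chain B A n -> has_chain B' A' n.
Proof.
case=> N [h s]; exists (fun i => set_add (f @` N i) A'); split=> i ilt.
  have [sN AN NB] := h i ilt; split.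
  - by apply: submod_add => //; apply: submod_im.
  - exact/sub_set_addr/submod_im.
  - by apply: set_add_sub => // _ [v /NB Bv <-]; apply: fB.
have [sN AN NB] := h _ ilt; have [sN0 AN0 NB0] := h i (ltnW ilt).
have [NN nN] := s i ilt; split.
  by move=> _ [_ [v Nv <-] [w Aw <-]]; exists (f v); [exists v => //; apply: NN|exists w].
move=> ge; apply: nN => v Nv.
have [|_ [u Nu <-] [w Aw e]] := ge (f v).
  by apply: sub_set_addl => //; exists v.
rewrite -[v](subrK u); apply: submodD => //; apply: AN0.
apply/f_inj; first by apply: submodB => //; [apply: NB|apply: NB0].
by rewrite linB -e addrC addKr.
Qed.

Lemma haslen_transfer n : haslen B A n <-> haslen B' A' n.
Proof.
split=> -[h h']; split; [exact: has_chain_im| |exact: has_chain_preim|];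
  by move=> hn; apply: h'; move: hn; (apply: has_chain_preim || apply: has_chain_im).
Qed.

End LengthTransfer.
End LinearImage.

(** * Ideals *)

Section IdealArithmetic.
Context {R : comNzRingType}.
Implicit Types (I J K P m : set R) (a b x y : R).

Lemma ideal0 K : ideal K -> K 0.
Proof. by case. Qed.

Lemma idealD K x y : ideal K -> K x -> K y -> K (x + y).
Proof. exact: submodD. Qed.

Lemma idealN K x : ideal K -> K x -> K (- x).
Proof. exact: submodN. Qed.

Lemma idealB K x y : ideal K -> K x -> K y -> K (x - y).
Proof. exact: submodB. Qed.

Lemma ideal_mull K x y : ideal K -> K x -> K (y * x).
Proof. exact: (@submodZ R R^o K y x). Qed.

Lemma ideal_mulr K x y : ideal K -> K x -> K (x * y).
Proof. by rewrite mulrC; apply: ideal_mull. Qed.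

Lemma ideal_setT : ideal [set: R].
Proof. exact: submod_setT. Qed.

Lemma ideal_gen_ideal (G : set R) : ideal (ideal_gen G).
Proof.
split=> [K [[K0 _] _] //|c u v hu hv K [iK GK]].
by apply: iK.2; [apply: hu|apply: hv].
Qed.

Lemma sub_ideal_gen (G : set R) : G `<=` ideal_gen G.
Proof. by move=> x Gx K [_]; apply. Qed.

Lemma ideal_gen_min (G K : set R) : ideal K -> G `<=` K -> ideal_gen G `<=` K.
Proof. by move=> iK GK x; apply. Qed.

Lemma ideal_mul_ideal I J : ideal (ideal_mul I J).
Proof. exact: ideal_gen_ideal. Qed.
Hint Resolve ideal_mul_ideal : core.

Lemma mem_ideal_mul I J x y : I x -> J y -> ideal_mul I J (x * y).
Proof. by move=> Ix Jy; apply: sub_ideal_gen; exists x => //; exists y. Qed.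

Lemma ideal_mul_min I J K : ideal K ->
  (forall x y, I x -> J y -> K (x * y)) -> ideal_mul I J `<=` K.
Proof.
by move=> iK h; apply: ideal_gen_min => // _ [x Ix [y Jy <-]]; apply: h.
Qed.

Lemma ideal_mulC I J : ideal_mul I J = ideal_mul J I.
Proof.
by apply/seteqP; split; apply: ideal_mul_min => // x y ? ?;
  rewrite mulrC; apply: mem_ideal_mul.
Qed.

Lemma ideal_mulTl I : ideal I -> ideal_mul setT I = I.
Proof.
move=> iI; apply/seteqP; split=> [|x Ix]; last first.
  by rewrite -[x]mul1r; apply: mem_ideal_mul.
by apply: ideal_mul_min => // x y _ Iy; apply: ideal_mull.
Qed.

Definition colon K (G : set R) : set R := [set x | forall y, G y -> K (x * y)].

Lemma colon_ideal K (G : set R) : ideal K -> ideal (colon K G).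
Proof.
move=> iK; split=> [y _|c u v hu hv y Gy]; first by rewrite mul0r; apply: ideal0.
change (K ((c * u + v) * y)); rewrite mulrDl -mulrA.
by apply: idealD => //; [apply: ideal_mull => //; apply: hu|apply: hv].
Qed.

Lemma ideal_mul_subA I J K : ideal_mul (ideal_mul I J) K `<=` ideal_mul I (ideal_mul J K).
Proof.
apply: ideal_mul_min => // z k + Kk.
(* Passing to a colon ideal reduces the claim for [z] in [I J] to the generators [x * y]. *)
suff : ideal_mul I J `<=` colon (ideal_mul I (ideal_mul J K)) K by move=> h /h; apply.
apply: ideal_mul_min; first exact: colon_ideal.
move=> x y Ix Jy k' Kk'; rewrite -mulrA; do 2!apply: mem_ideal_mul => //.
Qed.

Lemma ideal_mulA I J K : ideal_mul I (ideal_mul J K) = ideal_mul (ideal_mul I J) K.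
Proof.
apply/seteqP; split; last exact: ideal_mul_subA.
rewrite ideal_mulC (ideal_mulC J) (ideal_mulC _ K) (ideal_mulC I).
exact: ideal_mul_subA.
Qed.

Lemma ideal_mulACA I J K L :
  ideal_mul (ideal_mul I J) (ideal_mul K L) = ideal_mul (ideal_mul I K) (ideal_mul J L).
Proof. by rewrite -!ideal_mulA (ideal_mulA J) (ideal_mulC J K) !ideal_mulA. Qed.

Lemma ideal_exp_ideal I n : ideal (ideal_exp I n).
Proof. by case: n => [|n]; [exact: ideal_setT|exact: ideal_mul_ideal]. Qed.
Hint Resolve ideal_exp_ideal : core.

Lemma ideal_expS I n : ideal_exp I n.+1 = ideal_mul I (ideal_exp I n).
Proof. by []. Qed.

Lemma ideal_expD I r s : ideal_exp I (r + s) = ideal_mul (ideal_exp I r) (ideal_exp I s).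
Proof.
elim: r => [|r IH]; first by rewrite ideal_mulTl.
by rewrite addSn !ideal_expS IH ideal_mulA.
Qed.

Lemma ideal_exp_mul I J n :
  ideal_exp (ideal_mul I J) n = ideal_mul (ideal_exp I n) (ideal_exp J n).
Proof.
elim: n => [|n IH]; first by rewrite ideal_mulTl //; apply: ideal_setT.
by rewrite !ideal_expS IH ideal_mulACA.
Qed.

Lemma mem_ideal_exp I n x : I x -> ideal_exp I n (x ^+ n).
Proof.
by move=> Ix; elim: n => [//|n IH]; rewrite exprS; apply: mem_ideal_mul.
Qed.

Definition mono_ideal I J r s := ideal_mul (ideal_exp I r) (ideal_exp J s).

Lemma ideal_exp2E I J (r s : nat) : ideal_exp2 I J r%:Z s%:Z = mono_ideal I J r s.
Proof. by []. Qed.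

Lemma mono_ideal_ideal I J r s : ideal (mono_ideal I J r s).
Proof. exact: ideal_mul_ideal. Qed.
Hint Resolve mono_ideal_ideal : core.

Lemma mono_idealSl I J r s : mono_ideal I J r.+1 s = ideal_mul I (mono_ideal I J r s).
Proof. by rewrite /mono_ideal ideal_expS ideal_mulA. Qed.

Lemma mono_idealSr I J r s : mono_ideal I J r s.+1 = ideal_mul J (mono_ideal I J r s).
Proof. by rewrite /mono_ideal ideal_expS ideal_mulA (ideal_mulC _ J) -ideal_mulA. Qed.

Lemma mono_idealC I J r s : mono_ideal I J r s = mono_ideal J I s r.
Proof. exact: ideal_mulC. Qed.

Lemma mono_ideal0r I J s : mono_ideal I J 0 s = ideal_exp J s.
Proof. exact: ideal_mulTl. Qed.

Lemma mono_ideal0l I J r : mono_ideal I J r 0 = ideal_exp I r.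
Proof. by rewrite mono_idealC mono_ideal0r. Qed.

Lemma elt_mul_ideal a K : ideal K -> ideal (elt_mul a K).
Proof.
move=> iK; split; first by exists 0; [exact: ideal0|rewrite mulr0].
move=> c _ _ [u Ku <-] [v Kv <-]; exists (c * u + v); first exact: iK.2.
by rewrite mulrDr mulrCA.
Qed.

Lemma ideal_add_ideal I J : ideal I -> ideal J -> ideal (ideal_add I J).
Proof. exact: submod_add. Qed.

Lemma sub_ideal_addl I J : ideal J -> I `<=` ideal_add I J.
Proof. exact: sub_set_addl. Qed.

Lemma sub_ideal_addr I J : ideal I -> J `<=` ideal_add I J.
Proof. exact: sub_set_addr. Qed.

Lemma ideal_add_sub I J K : ideal K -> I `<=` K -> J `<=` K -> ideal_add I J `<=` K.
Proof. exact: set_add_sub. Qed.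

Definition ideal_len (B A : set R) (n : nat) := haslen (B : set R^o) A n.

End IdealArithmetic.

#[export] Hint Resolve ideal_mul_ideal ideal_exp_ideal mono_ideal_ideal
  ideal_setT : core.

(** * Koszul relations and Noetherian local rings *)

Section Koszul.
Context {R : comNzRingType}.
Implicit Types (K : set R) (p q x y z u v w : R).

Definition ideal2 p q : set R := ideal_add (elt_mul p setT) (elt_mul q setT).

Lemma ideal2_ideal p q : ideal (ideal2 p q).
Proof. by apply: ideal_add_ideal; apply: elt_mul_ideal. Qed.

Lemma ideal2P p q z : ideal2 p q z <-> exists u v, z = p * u + q * v.
Proof.
split=> [[_ [u _ <-] [_ [v _ <-] <-]]|[u [v ->]]]; first by exists u, v.
by exists (p * u); [exists u|exists (q * v) => //; exists v].
Qed.

(** A regular sequence of length two, without properness of [(x, y)]; this form is stable under all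
    powers, including exponent zero. *)
Definition regular_pair x y :=
  (forall z, x * z = 0 -> z = 0) /\
  (forall z, elt_mul x setT (y * z) -> elt_mul x setT z).

(* For a pair [p, q] this is the vanishing of the first Koszul homology. *)
Definition koszul_exact p q :=
  forall u v, p * u + q * v = 0 -> exists w, u = w * q /\ v = - (w * p).

(** Powers of [y] are removed one factor at a time. If [y z] lies in [(x^(k+1))], then [z = x z'],
    and cancelling [x] puts [y z'] in [(x^k)], so induction on [k] applies. *)
Lemma regular_pairX x y k l : regular_pair x y -> regular_pair (x ^+ k) (y ^+ l).
Proof.
move=> [hx hy]; have hxk i z : x ^+ i * z = 0 -> z = 0.
  by elim: i z => [|i IH] z; rewrite ?mul1r // exprS -mulrA => /hx/IH.
split; first exact: hxk.
suff h z : elt_mul (x ^+ k) setT (y * z) -> elt_mul (x ^+ k) setT z.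
  elim: l => [|l IH] z; first by rewrite mul1r.
  by rewrite exprS -mulrA => /h/IH.
elim: k z => [|k IH] z [u _ e]; first by exists z; rewrite ?mul1r.
have [|z' _ ez] := hy z; first by exists (x ^+ k * u); rewrite // mulrA -exprS.
have [|t _ et] := IH z'.
  exists u => //; apply/eqP; rewrite -subr_eq0; apply/eqP/hx.
  by rewrite mulrBr mulrA -exprS e -ez; ring.
by exists t => //; rewrite -ez -et exprS mulrA.
Qed.

(* Multiplying a syzygy [(u, v)] of [(p, q)] by an element of [(p, q)] makes it
   a multiple of [(q, -p)]; the multipliers obtained from [x] and from [y] are
   then compared. *)
Lemma koszul_exact_regular_pair p q x y :
  regular_pair x y -> ideal2 p q x -> ideal2 p q y -> koszul_exact p q.
Proof.
move=> [hx hy] /ideal2P[al [be ex]] /ideal2P[ga [de ey]] u v e.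
have ev : q * v = - (p * u) by apply/eqP; rewrite -addr_eq0 addrC e.
set wx := be * u - al * v; set wy := de * u - ga * v.
have xu : x * u = wx * q by rewrite ex /wx mulrBl -[al * v * q]mulrA [v * q]mulrC ev; ring.
have xv : x * v = - (wx * p).
  rewrite ex /wx mulrDl -[q * be * v]mulrA [be * v]mulrC mulrA ev; ring.
have yu : y * u = wy * q by rewrite ey /wy mulrBl -[ga * v * q]mulrA [v * q]mulrC ev; ring.
have yv : y * v = - (wy * p).
  rewrite ey /wy mulrDl -[q * de * v]mulrA [de * v]mulrC mulrA ev; ring.
(* [D] is killed by [p] and [q], hence by [x], so [D = 0]. Then [y wx = x wy], and regularity of [y]
   modulo [x] gives [wx = x w]; this [w] is the required multiplier after cancelling [x]. *)
set D := y * wx - x * wy.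
have Dq : D * q = 0.
  by rewrite /D mulrBl -mulrA -xu -mulrA -yu; ring.
have Dp : D * p = 0.
  have -> : D * p = y * (wx * p) - x * (wy * p) by rewrite /D; ring.
  have -> : wx * p = - (x * v) by rewrite xv opprK.
  have -> : wy * p = - (y * v) by rewrite yv opprK.
  by ring.
have D0 : D = 0.
  apply: hx; rewrite ex; transitivity (al * (D * p) + be * (D * q)); first by ring.
  by rewrite Dp Dq !mulr0 addr0.
have [|w _ ew] := hy wx.
  exists wy => //; apply/esym/eqP; rewrite -subr_eq0; apply/eqP; exact: D0.
exists w; split; apply/eqP; rewrite -subr_eq0; apply/eqP/hx.
  by rewrite mulrBr xu -ew; ring.
by rewrite opprK mulrDr xv -ew; ring.
Qed.

End Koszul.

(** * Nakayama, finite colength and avoidance in a Noetherian local ring *)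

Section NoetherianLocal.
Context {R : comNzRingType} (m : set R).
Hypotheses (R_noetherian : noetherian R) (R_local : local_ring m).
Implicit Types (I J K P N A B : set R) (x y z : R).

(** Otherwise choice produces a strictly increasing sequence in [F]; the finitely many generators of
    its union all lie in one term, a contradiction. *)
Lemma noetherian_max (F : set (set R)) K0 : (forall K, F K -> ideal K) -> F K0 ->
  exists2 K, F K & forall K', F K' -> K `<=` K' -> K' = K.
Proof.
move=> Fi FK0; apply: contrapT => nmax.
have step (K : {K | F K}) : exists K' : {K | F K}, sval K `<` sval K'.
  case: K => K FK /=; apply: contrapT => h; apply: nmax; exists K => // K' FK' KK'.
  apply: contrapT => ne; apply: h; exists (exist _ K' FK'); split=> //= K'K.
  by apply: ne; apply/seteqP.
have [g hg] := choice step.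
pose N n := sval (iter n g (exist _ K0 FK0)).
have sN n : N n `<` N n.+1 by exact: hg.
have iN n : ideal (N n) by apply: Fi; exact: (svalP (iter n g _)).
have mono i j : (i <= j)%N -> N i `<=` N j.
  elim: j => [|j IH]; first by rewrite leqn0 => /eqP-> x.
  rewrite leq_eqVlt => /orP[/eqP-> x //|/IH h]; exact: subset_trans h (properW (sN j)).
pose U : set R := [set x | exists n, N n x].
have iU : ideal U.
  split; first by exists 0%N; exact: ideal0 (iN _).
  move=> c u v [i Ni] [j Nj]; exists (maxn i j); apply: (iN _).2.
    by apply: mono Ni; apply: leq_maxl.
  by apply: mono Nj; apply: leq_maxr.
have [s Us] := R_noetherian iU.
have [n sNn] : exists n, forall x, x \in s -> N n x.
  have : forall x, x \in s -> U x by move=> x xs; rewrite Us; apply: sub_ideal_gen.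
  elim: s {Us} => [|x s IH] h; first by exists 0%N.
  have [y ys|n hn] := IH; first by apply: h; rewrite inE ys orbT.
  have [k hk] := h x (mem_head _ _); exists (maxn n k) => y.
  rewrite inE => /orP[/eqP->|/hn Ny]; first by apply: mono hk; apply: leq_maxr.
  by apply: mono Ny; apply: leq_maxl.
case: (sN n) => _; apply=> x Nx.
have : U x by exists n.+1.
by rewrite Us; apply: ideal_gen_min.
Qed.

Lemma m_ideal : ideal m. Proof. by case: R_local => -[]. Qed.
Lemma m_proper : ~ m 1. Proof. by case: R_local => -[]. Qed.

Lemma unit_outside_m u : ~ m u -> exists v, u * v = 1.
Proof.
move=> mu; apply: contrapT => nu.
pose F K := [/\ ideal K, ~ K 1 & K u].
have [| |K [iK K1 Ku] Kmax] := @noetherian_max F (elt_mul u setT).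
- by move=> K [].
- split; first exact: elt_mul_ideal.
    by case=> v _ e; apply: nu; exists v.
  by exists 1; rewrite ?mulr1.
suff mK : maximal_ideal K by apply: mu; rewrite -(R_local.2 K mK).
split=> // K' iK' K'1 KK'; apply: Kmax => //; split=> //; exact: KK'.
Qed.

(** Here [A] is any set. Choose [z] in [A] outside [B] with [B + (z)] maximal. As [z] is [b z']
    modulo [B], maximality gives [z' = be + z c] with [be] in [B]. Hence [(1 - b c) z'] lies in [B],
    and [1 - b c] is a unit. *)
Lemma nakayama A B b : ideal B -> m b ->
  (forall z, A z -> exists2 z', A z' & B (z - b * z')) -> A `<=` B.
Proof.
move=> iB mb h z Az; apply: contrapT => Bz.
pose F K := exists2 z, K = ideal_add B (elt_mul z setT) & A z /\ ~ B z.
have [| |K [{}z -> [{}Az {}Bz]] Kmax] := @noetherian_max F (ideal_add B (elt_mul z setT)).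
- by move=> _ [x -> _]; apply: ideal_add_ideal => //; apply: elt_mul_ideal.
- by exists z.
have [z' Az' Bzz'] := h z Az.
have Bz' : ~ B z'.
  move=> Bz'; apply: Bz; rewrite -[z](subrK (b * z')).
  by apply: idealD => //; apply: ideal_mull.
have : ideal_add B (elt_mul z' setT) z'.
  by apply: sub_ideal_addr => //; exists 1; rewrite ?mulr1.
rewrite (Kmax (ideal_add B (elt_mul z' setT))); first last.
- apply: ideal_add_sub; [by apply: ideal_add_ideal => //; apply: elt_mul_ideal| |].
    by apply: sub_ideal_addl; apply: elt_mul_ideal.
  move=> _ [c _ <-]; exists ((z - b * z') * c); first exact: ideal_mulr.
  by exists (z' * (b * c)); [exists (b * c)|ring].
- by exists z'.
case=> be Bbe [_ [c _ <-] e].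
have [|v ev] := @unit_outside_m (1 - b * c).
  move=> m1; apply: m_proper; rewrite -(subrK (b * c) 1).
  by apply: idealD => //; [exact: m_ideal|apply: ideal_mulr => //; exact: m_ideal].
apply: Bz'; rewrite -[z']mul1r -ev mulrAC; apply: ideal_mulr => //.
have -> : (1 - b * c) * z' = be + c * (z - b * z').
  by transitivity (be + z * c - b * c * z'); [rewrite e|]; ring.
by apply: idealD => //; apply: ideal_mull.
Qed.

(** If [p z = 0], then [(z, 0)] is a syzygy, so [z = w q] with [w p = 0]. The annihilator of [p]
    thus equals [q] times itself, and Nakayama applies. *)
Lemma koszul_exact_regular p q z : m q -> koszul_exact p q -> p * z = 0 -> z = 0.
Proof.
move=> mq pq pz; apply: (@nakayama [set z | p * z = 0] [set 0] q) => //.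
  by split=> // c u v /= -> ->; rewrite scaler0 addr0.
move=> {pz}z /= pz; have [|w [zw pw]] := pq z 0; first by rewrite pz mulr0 addr0.
exists w; first by apply/oppr_inj; rewrite mulrC -pw oppr0.
by rewrite zw mulrC subrr.
Qed.

(** The depth equals some Krull dimension [d]. Prime chains can be truncated, so [d = 2], and the
    sequence realising the depth is the pair. *)
Lemma dim2_regular_pair : cohen_macaulay m -> krull_dim R 2 ->
  exists x y, [/\ m x, m y & regular_pair x y].
Proof.
move=> [d [[s [sreg sm sd]] _] dimd] dim2.
have chain_le n k : (k <= n)%N -> has_prime_chain (R := R) n -> has_prime_chain (R := R) k.
  move=> kn [P [h1 h2]]; exists P; split=> i ik; [apply: h1|apply: h2].
    exact: leq_trans kn.
  exact: leq_trans kn.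
have d2 : d = 2%N.
  case: dimd dim2 => h1 h2 [h3 h4].
  case: (ltngtP d 2) => // [d2|d2].
    by case: h2; apply: chain_le h3.
  by case: h4; apply: chain_le h1.
rewrite d2 in sd; case: s sd sreg sm => [|x [|y []]] //= _ [_ sreg] sm.
exists x, y; split; [by apply: sm; rewrite /= mem_head| |split].
- by apply: sm; rewrite /= inE mem_head orbT.
- move=> z xz; have : ideal_gen [set` ([::] : seq R)] z.
    by apply: (sreg 0%N) => //=; rewrite xz; exact: ideal0 (ideal_gen_ideal _).
  apply: (@ideal_gen_min _ _ [set 0]) => [|//].
  by split=> // c u v /= -> ->; rewrite scaler0 addr0.
move=> z [u _ e]; have : ideal_gen [set` [:: x]] z.
  apply: (sreg 1%N) => //=; rewrite -e; apply: (@ideal_mulr _ (ideal_gen _)).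
    exact: ideal_gen_ideal.
  by apply: sub_ideal_gen; rewrite /= mem_head.
apply: ideal_gen_min; first exact: elt_mul_ideal.
by move=> v /=; rewrite inE => /eqP->; exists 1; rewrite ?mulr1.
Qed.

(** Suitable powers of a regular pair in [m] lie in [(p, q)], and they still form a regular pair. *)
Lemma koszul_exact_m_radical p q : cohen_macaulay m -> krull_dim R 2 ->
  m `<=` radical (ideal2 p q) -> koszul_exact p q.
Proof.
move=> CM dim2 h; have [x [y [mx my xy]]] := dim2_regular_pair CM dim2.
have [[k hk] [l hl]] := (h x mx, h y my).
exact: (koszul_exact_regular_pair (regular_pairX k l xy)).
Qed.

(** In a maximal counterexample [K], pick [z] outside [K] with [K : z] maximal. Then [m z] lies in
    [K], so [(K + (z)) / K] has length at most one, while [K + (z)] has finite colength. *)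
Lemma finite_colength K : ideal K -> m `<=` radical K -> exists n, ideal_len setT K n.
Proof.
move=> iK mK; apply: contrapT => nfin.
pose F K := [/\ ideal K, m `<=` radical K & ~ exists n, ideal_len setT K n].
have [| |{iK mK nfin}K [iK mK nfin] Kmax] := @noetherian_max F K;
  [by move=> ? []|by split|].
have K1 : ~ K 1.
  move=> K1; apply: nfin; exists 0%N; suff -> : K = setT by apply/(@haslen0 R R^o).
  by apply/seteqP; split=> // x _; rewrite -[x]mulr1; apply: ideal_mull.
pose ann z : set R := colon K [set z].
have [| |C [z -> Kz] Cmax] :=
    @noetherian_max [set C | exists2 z, C = ann z & ~ K z] (ann 1).
- by move=> _ [z -> _]; apply: colon_ideal.
- by exists 1.
have mz x : m x -> K (x * z).
  move=> mx; have [n Kn] := mK x mx.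
  have : exists j, K (x ^+ j * z) by exists n; apply: ideal_mulr.
  move=> /cid[j hj]; elim: j hj => [|j IH] hj; first by case: Kz; rewrite -[z]mul1r.
  have [/IH//|Kj] := pselect (K (x ^+ j * z)).
  suff : ann z x by apply.
  rewrite -(Cmax (ann (x ^+ j * z))).
  - by move=> _ ->; rewrite mulrA -exprS.
  - by exists (x ^+ j * z).
  - move=> c /(_ z erefl) cz _ ->; rewrite mulrCA; exact: ideal_mull.
pose K' := ideal_add K (elt_mul z setT).
have iK' : ideal K' by apply: ideal_add_ideal => //; apply: elt_mul_ideal.
have KK' : K `<=` K' by apply: sub_ideal_addl; apply: elt_mul_ideal.
have K'z : K' z by apply: sub_ideal_addr => //; exists 1; rewrite ?mulr1.
have [p hp] : exists n, ideal_len setT K' n.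
  apply: contrapT => h; apply: Kz; rewrite -(Kmax K') //; split=> // x /mK[n Kn].
  by exists n; apply: KK'.
have [n _ hn] : exists2 n, (n < 2)%N & ideal_len K' K n.
  apply: has_chain_bound => // -[N [h s]].
  have [iN1 KN1 N1K] := h 1%N isT; have [iN0 KN0 N0K] := h 0%N isT.
  have [_ N2K] := s 1%N isT; apply: N2K; have [_ _ N2K] := h 2%N isT.
  apply: subset_trans N2K _; have [_ N01] := s 0%N isT.
  have [u Nu Ku] : exists2 u, N 1%N u & ~ K u.
    apply: contrapT => hu; apply: N01 => u Nu; apply: KN0.
    by apply: contrapT => Ku; apply: hu; exists u.
  have [k Kk [_ [c _ <-] e]] := N1K u Nu.
  have [|v cv] := @unit_outside_m c.
    by move=> /mz mc; apply: Ku; rewrite -e; apply: idealD => //; rewrite mulrC.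
  apply: ideal_add_sub => // _ [d _ <-].
  have -> : z * d = (u - k) * (v * d).
    by rewrite -e addrC addKr -mulrA mulrA [z * c]mulrC -mulrA mulrCA [c * _]mulrA cv; ring.
  by apply: ideal_mulr => //; apply: idealB => //; apply: KN1.
apply: nfin; exists (p + n)%N; exact: haslenD hp hn.
Qed.

(** Let [y] avoid the first [t] ideals and lie in [N t], and let [v] avoid [N t]. Then every
    [v + l y] avoids [N t]. Two values of [l] with distinct residues cannot put [v + l y] in the
    same [N i], [i < t], since the difference is a unit times [y]; so only finitely many residues
    are bad. *)
Lemma avoid_union (I : set R) (N : nat -> set R) t : infinite_residue_field m ->
    ideal I -> (forall i, (i < t)%N -> ideal (N i) /\ ~ I `<=` N i) ->
  exists2 y, I y & forall i, (i < t)%N -> ~ N i y.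
Proof.
move=> inf iI; elim: t => [|t IH] h; first by exists 0 => //; apply: ideal0.
have [i it|y Iy hy] := IH; first by apply: h; apply: leqW.
have [Nty|Nty] := pselect (N t y); last first.
  by exists y => // i; rewrite ltnS leq_eqVlt => /orP[/eqP->|/hy].
have [iNt INt] := h t (ltnSn t).
have [v Iv Ntv] : exists2 v, I v & ~ N t v.
  apply: contrapT => hv; apply: INt => v Iv.
  by apply: contrapT => Nv; apply: hv; exists v.
have [l hl] : exists l, forall i, (i < t)%N -> ~ N i (v + l * y).
  apply: contrapT => bad.
  have {}bad l : exists2 i, (i < t)%N & N i (v + l * y).
    apply: contrapT => hl; apply: bad; exists l => i it Nl.
    by apply: hl; exists i.
  have /choice[f hf] i : exists l, (exists l, N i (v + l * y)) -> N i (v + l * y).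
    have [[l hl]|nl] := pselect (exists l, N i (v + l * y)); first by exists l.
    by exists 0.
  apply: inf; pose cls x := [set y | m (y - x)].
  apply: (@sub_finite_set _ _ ((cls \o f) @` `I_t)); last first.
    by apply: finite_image; apply: finite_II.
  move=> _ [l _ <-]; have [i it Nl] := bad l; exists i => //=.
  have Nf := hf i (ex_intro _ l Nl); have [iNi _] := h i (leqW it).
  have mfl : m (f i - l).
    apply: contrapT => /unit_outside_m[w ew]; apply: (hy i it).
    have -> : y = ((v + f i * y) - (v + l * y)) * w.
      by transitivity ((f i - l) * w * y); [rewrite ew mul1r|ring].
    by apply: ideal_mulr => //; apply: idealB.
  have im := m_ideal.
  apply/seteqP; split=> z /= mz.
    have -> : z - l = (z - f i) + (f i - l) by ring.
    by apply: idealD.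
  change (m (z - f i)); have -> : z - f i = (z - l) - (f i - l) by ring.
  by apply: idealB.
exists (v + l * y); first by apply: idealD => //; apply: ideal_mull.
move=> i; rewrite ltnS leq_eqVlt => /orP[/eqP-> Nv|]; last exact: hl.
by apply: Ntv; rewrite -[v](addrK (l * y)); apply: idealB => //; apply: ideal_mull.
Qed.

End NoetherianLocal.

(** * Koszul complexes and colengths *)

Section KoszulLength.
Context {R : comNzRingType}.
Implicit Types (A B : set R) (p q : R).

Let R2 : lmodType R := (R^o * R^o)%type.

Let prod_set A B : set R2 := [set z | A z.1 /\ B z.2].

Let prod_set_submod A B : ideal A -> ideal B -> submod (prod_set A B).
Proof.
move=> iA iB; split; first by split; apply: ideal0.
by move=> c u v [? ?] [? ?]; split; [apply: iA.2|apply: iB.2].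
Qed.

Lemma haslen_prod A B a b : ideal A -> ideal B ->
  ideal_len setT A a -> ideal_len setT B b ->
  haslen [set: R2] (prod_set A B) (b + a).
Proof.
move=> iA iB hA hB; have iT := @ideal_setT R.
apply: (@haslenD _ _ _ _ (prod_set setT B)) => //.
- exact: prod_set_submod.
- by move=> z [].
- apply/(@haslen_transfer _ R2 R^o snd _ _ _ B setT) => //.
  + by move=> w _; exists (0, w) => //=; rewrite subrr; apply: ideal0.
  + by move=> z _; split=> [|[]].
- apply/(@haslen_transfer _ R2 R^o fst _ _ _ A setT) => //.
  + exact: prod_set_submod.
  + by move=> z [].
  + move=> w _; exists (w, 0) => /=; first by split=> //; apply: ideal0.
    by rewrite subrr; apply: ideal0.
  + by move=> z [_ Bz]; split=> [|[]].
Qed.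

(* [pA + qB] is the image of [A x B] under [(u, v) |-> p u + q v : R^2 -> (p, q)],
   whose kernel is the image of [w |-> (w q, - w p)]. *)
Lemma koszul_length A B p q a b e : ideal A -> ideal B -> koszul_exact p q ->
    ideal_len setT A a -> ideal_len setT B b -> ideal_len setT (ideal2 p q) e ->
  exists d c, [/\ ideal_len setT (ideal_add (elt_mul p A) (elt_mul q B)) d,
    ideal_len setT (colon A [set q] `&` colon B [set p]) c &
    (d + c = e + a + b)%N].
Proof.
move=> iA iB pq hA hB hpq; have iT := @ideal_setT R.
pose phi (z : R2) : R^o := p * z.1 + q * z.2.
pose psi (w : R^o) : R2 := (w * q, - (w * p)).
have phi_lin : linear phi.
  by move=> c u v; rewrite /phi /= /GRing.scale /=; ring.
have psi_lin : linear psi.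
  move=> c u v; rewrite /psi; congr pair => /=; rewrite /GRing.scale /=; ring.
set M := ideal_add _ _.
have iM : ideal M by apply: ideal_add_ideal; apply: elt_mul_ideal.
have Mpq : M `<=` ideal2 p q.
  by move=> _ [_ [u _ <-] [_ [v _ <-] <-]]; apply/ideal2P; exists u, v.
(* By exactness [S] is the preimage of [M] under [phi]. So [phi] identifies [R^2 / S] with
   [(p, q) / M] ([h1]), and [psi] identifies [R / ((A : q) /\ (B : p))] with [S / (A x B)]
   ([h2]). *)
pose S := set_add (prod_set A B) (range psi).
have sAB := prod_set_submod iA iB.
have sS : submod S.
  by apply: submod_add => //; apply: submod_im => //; exact: submod_setT.
have ABS : prod_set A B `<=` S.
  by apply: sub_set_addl; apply: submod_im => //; exact: submod_setT.
have h1 n : haslen [set: R2] S n <-> ideal_len (ideal2 p q) M n.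
  apply: (haslen_transfer phi_lin) => //.
  - exact: ideal2_ideal.
  - by move=> z _; apply/ideal2P; exists z.1, z.2.
  - move=> w /ideal2P[u [v ->]]; exists (u, v) => //.
    by rewrite subrr; apply: ideal0.
  - move=> [u v] _; split=> [[_ [u' Au <-] [_ [v' Bv <-] e']]|].
      have [|w [eu ev]] := pq (u - u') (v - v').
        by apply/eqP; rewrite !mulrBr addrACA -opprD subr_eq0; apply/eqP.
      exists (u', v') => //; exists (psi w); first by exists w.
      by rewrite /psi -eu -ev; congr pair; rewrite /= addrC subrK.
    case=> [[u' v'] [/= Au Bv] [_ [w _ <-] [<- <-]]].
    exists (p * u'); first by exists u'.
    by exists (q * v'); [exists v'|rewrite /phi /=; ring].
have iC : ideal (colon A [set q] `&` colon B [set p]).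
  by apply: submod_setI; apply: colon_ideal.
have h2 n : ideal_len setT (colon A [set q] `&` colon B [set p]) n <->
            haslen S (prod_set A B) n.
  apply: (haslen_transfer psi_lin) => //.
  - by move=> w _; apply: sub_set_addr => //; exists w.
  - by move=> _ [z zAB [_ [w _ <-] <-]]; exists w => //; rewrite addrK.
  - move=> w _; split=> [[Aw Bw]|[Aw Bw]].
      by split=> _ ->; [|rewrite -[_ * _]opprK; apply: idealN].
    by split; [apply: Aw|apply: idealN => //; apply: Bw].
have [//|n1 [n2 [en hn1 hn2]]] :=
  haslen_cut sAB (@submod_setT _ R2) sS ABS _ (haslen_prod iA iB hA hB).
exists (e + n1)%N, n2; split; [|exact/h2|lia].
apply: (@haslenD R R^o M setT (ideal2 p q)) => //; last exact/h1.
exact: ideal2_ideal.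
Qed.

End KoszulLength.

(** * Colengths as natural numbers *)

Section Colength.
Context {R : comNzRingType} (m : set R).
Hypotheses (R_noetherian : noetherian R) (R_local : local_ring m).
Implicit Types (I J K A B : set R) (p q x y z : R).

(* The colength of [K], with junk value [0] when it is infinite. *)
Definition len K : nat := xget 0%N [set n | ideal_len setT K n].

Lemma len_eq K n : ideal_len setT K n -> len K = n.
Proof.
move=> h; rewrite /len; case: xgetP => [k _ hk|/(_ n)//].
exact: haslen_uniq hk h.
Qed.

(** The [m]-primary ideals together with [R] itself, that is, the open ideals of the [m]-adic
    topology; including [R] covers zero exponents. *)
Definition m_open K := ideal K /\ m `<=` radical K.

Lemma lenP K : m_open K -> ideal_len setT K (len K).
Proof.
by move=> [iK mK]; have [n hn] := finite_colength R_noetherian R_local iK mK;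
  rewrite (len_eq hn).
Qed.

Lemma len_setT : len (setT : set R) = 0%N.
Proof. by apply: len_eq; apply/(@haslen0 R R^o). Qed.

Lemma m_open_setT : m_open setT.
Proof. by split=> // x _; exists 0%N. Qed.

Lemma m_open_sub K K' : ideal K' -> K `<=` K' -> m_open K -> m_open K'.
Proof.
move=> iK' KK' [_ mK]; split=> // x /mK[n Kn]; exists n; exact: KK'.
Qed.

Lemma m_open_mul I J : m_open I -> m_open J -> m_open (ideal_mul I J).
Proof.
move=> [_ mI] [_ mJ]; split=> // x mx; have [[n In] [k Jk]] := (mI x mx, mJ x mx).
by exists (n + k)%N; rewrite exprD; apply: mem_ideal_mul.
Qed.

Lemma m_open_exp I n : m_open I -> m_open (ideal_exp I n).
Proof.
move=> cI; elim: n => [|n IH]; [exact: m_open_setT|exact: m_open_mul].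
Qed.

Lemma m_open_mono I J r s : m_open I -> m_open J -> m_open (mono_ideal I J r s).
Proof. by move=> ? ?; apply: m_open_mul; apply: m_open_exp. Qed.

Lemma ideal2C p q : ideal2 p q = ideal2 q p.
Proof.
by apply/seteqP; split=> z /ideal2P[u [v ->]]; apply/ideal2P; exists v, u; rewrite addrC.
Qed.

Lemma m_open_ideal2X p q r s : m_open (ideal2 p q) -> m_open (ideal2 (p ^+ r) (q ^+ s)).
Proof.
suff h p' q' k : m_open (ideal2 p' q') -> m_open (ideal2 (p' ^+ k) q').
  by move=> /(h _ _ r); rewrite ideal2C => /(h _ _ s); rewrite ideal2C.
move=> [_ mpq]; split=> [|x /mpq[n /ideal2P[u [v e]]]]; first exact: ideal2_ideal.
exists (n * k)%N; rewrite exprM e; apply/ideal2P.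
have [c ->] : exists c, (p' * u + q' * v) ^+ k = p' ^+ k * u ^+ k + q' * c.
  elim: k => [|k [c ec]]; first by exists 0; rewrite !expr0; ring.
  by exists (v * (p' ^+ k * u ^+ k + q' * c) + p' * u * c); rewrite !exprS ec; ring.
by exists (u ^+ k), c.
Qed.

Lemma len_sub_eq K K' : m_open K -> ideal K' -> K `<=` K' ->
  exists2 n, ideal_len K' K n & (len K = len K' + n)%N.
Proof.
move=> cK iK' KK'; have [n1 [n2 [e h1 h2]]] :=
  haslen_cut cK.1 (ideal_setT : ideal setT) iK' KK' (@subsetT _ _) (lenP cK).
by exists n2 => //; rewrite (len_eq h1).
Qed.

(** Multiplication by [x] identifies [R / (K : x)] with [((x) + K) / K]. *)
Lemma len_colon K x : m_open K ->
  len K = (len (ideal_add (elt_mul x setT) K) + len (colon K [set x]))%N.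
Proof.
move=> cK; have iT := @ideal_setT R; have iK := cK.1.
set K' := ideal_add _ _.
have iK' : ideal K' by apply: ideal_add_ideal => //; apply: elt_mul_ideal.
have KK' : K `<=` K' by apply: sub_ideal_addr; apply: elt_mul_ideal.
have [n hn ->] := len_sub_eq cK iK' KK'; congr (_ + _)%N; apply/esym/len_eq.
apply/(@haslen_transfer R R^o R^o (fun w => x * w) _ _ _ K K') => //.
- by move=> c u v; rewrite /GRing.scale /=; ring.
- by move=> w _; apply: sub_ideal_addl => //; exists w.
- move=> _ [_ [w _ <-] [k Kk <-]]; exists w => //.
  by rewrite addrC addKr.
- move=> w _; split=> [xw _ ->|]; first by rewrite mulrC.
  by move/(_ x erefl); rewrite mulrC.
Qed.

Hypotheses (CM : cohen_macaulay m) (dim2 : krull_dim R 2).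

Lemma m_open_koszul_exact p q : m_open (ideal2 p q) -> koszul_exact p q.
Proof. by case=> _; apply: koszul_exact_m_radical. Qed.

Lemma len_koszul p q A B : m_open (ideal2 p q) -> m_open A -> m_open B ->
  exists2 d, ideal_len setT (ideal_add (elt_mul p A) (elt_mul q B)) d &
    (d + len (colon A [set q] `&` colon B [set p]) = len (ideal2 p q) + len A + len B)%N.
Proof.
move=> cpq cA cB.
have [d [c [hd /len_eq -> e]]] := koszul_length cA.1 cB.1
  (m_open_koszul_exact cpq) (lenP cA) (lenP cB) (lenP cpq).
by exists d.
Qed.

Lemma len_ideal2X p q r s : m_open (ideal2 p q) ->
  len (ideal2 (p ^+ r) (q ^+ s)) = (r * s * len (ideal2 p q))%N.
Proof.
suff h p' q' k : m_open (ideal2 p' q') ->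
    len (ideal2 (p' ^+ k) q') = (k * len (ideal2 p' q'))%N.
  move=> cpq; rewrite -mulnA -[q in RHS]expr1 h.
    by rewrite ideal2C (ideal2C p) !h // ideal2C.
  by rewrite -[p]expr1; apply: m_open_ideal2X.
move=> cpq; elim: k => [|k IH].
  rewrite mul0n -[RHS]len_setT; congr len; apply/seteqP; split=> // z _.
  by apply/ideal2P; exists z, 0; rewrite expr0; ring.
have ck : m_open (ideal2 (p' ^+ k) q') by rewrite -[q']expr1; apply: m_open_ideal2X.
(* Take [A = (p'^k, q')] and [B = R]: then [p' A + q' R = (p'^(k+1), q')] and both colon ideals are
   [R], so each step adds [l(R/(p', q'))]. *)
have [d /len_eq hd] := len_koszul cpq ck m_open_setT.
have -> : colon (ideal2 (p' ^+ k) q') [set q'] `&` colon setT [set p'] = setT.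
  apply/seteqP; split=> // z _; split=> // _ ->.
  by apply/ideal2P; exists 0, z; ring.
rewrite len_setT !addn0 IH mulSn => <-; rewrite -hd; congr len.
apply/seteqP; split=> z.
  move=> /ideal2P[u [v ->]]; exists (p' ^+ k.+1 * u); last by exists (q' * v) => //; exists v.
  exists (p' ^+ k * u); last by rewrite exprS mulrA.
  by apply/ideal2P; exists u, 0; ring.
move=> [_ [_ /ideal2P[u [v ->]] <-] [_ [w _ <-] <-]]; apply/ideal2P.
by exists u, (p' * v + w); rewrite exprS; ring.
Qed.

End Colength.

(** * A reduction modulo a *)

Section Reduction.
Context {R : comNzRingType} (m : set R).
Hypotheses (R_noetherian : noetherian R) (R_local : local_ring m)
  (CM : cohen_macaulay m) (dim2 : krull_dim R 2).
Implicit Types (I J K A B : set R) (p q x y z : R).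

(** This is the Koszul formula with [A = R]; [len_colon] then replaces [l(R/B) - l(R/(B : x))] by
    [l(R/((x) + B))]. *)
Lemma len_add_elt_mul x y B : m_open m (ideal2 x y) -> m_open m B ->
  ideal_len setT (ideal_add (elt_mul x setT) (elt_mul y B))
    (len (ideal2 x y) + len (ideal_add (elt_mul x setT) B)).
Proof.
move=> cxy cB.
have [d hd] := len_koszul R_noetherian R_local CM dim2 cxy (m_open_setT m) cB.
have -> : colon setT [set y] `&` colon B [set x] = colon B [set x].
  by apply/seteqP; split=> [z []|].
rewrite len_setT addn0 (len_colon R_noetherian R_local x cB) addnA.
by move=> /addIn <-.
Qed.

Lemma prod_ideal_exp I (y : nat -> R) u v :
  (forall i, (u <= i < v)%N -> I (y i)) -> ideal_exp I (v - u) (\prod_(u <= i < v) y i).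
Proof.
elim: v => [|v IH] h; first by rewrite big_geq.
have [uv|vu] := leqP u v; last first.
  by rewrite big_geq // (_ : (v.+1 - u = 0)%N) //; apply/eqP; rewrite subn_eq0.
rewrite big_nat_recr //= subSn // mulrC; apply: mem_ideal_mul.
  by apply: h; rewrite uv /=.
by apply: IH => i iv; apply: h; lia.
Qed.

Section GenericElement.
Variables (I : set R) (a b : R).
Hypotheses (m_inf : infinite_residue_field m) (cI : m_open m I) (mb : m b)
  (cab : m_open m (ideal2 a b)).

(** Once [I^(d+1)] lies in [H d y], Nakayama drops the last summand, and [y] generates a reduction
    of [I] modulo [a]. *)
Let H d y : set R :=
  ideal_add (elt_mul a setT)
    (ideal_add (elt_mul y (ideal_exp I d)) (elt_mul b (ideal_exp I d.+1))).

Let H_ideal d y : ideal (H d y).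
Proof. by do 2!(apply: ideal_add_ideal; first exact: elt_mul_ideal); apply: elt_mul_ideal. Qed.

(** Each new term avoids, for every [j < t], the ideal [N j] of those [x] with [P j x I^(d+1-(t-j))]
    inside [H d (y j)]. By induction no [N j] contains [I]. The products with [z] always lie in
    [I^(d+1)]. *)
Let generic_sequence d t : (forall y, I y -> ~ ideal_exp I d.+1 `<=` H d y) ->
  (t <= d.+1)%N -> exists2 y : nat -> R, forall i, (i < t)%N -> I (y i) &
    forall j, (j < t)%N -> exists2 z, ideal_exp I (d.+1 - (t - j.+1)) z &
      ~ H d (y j) ((\prod_(j.+1 <= i < t) y i) * z).
Proof.
move=> notH; elim: t => [_|t IH td]; first by exists (fun=> 0).
have [y Iy hy] := IH (ltnW td).
pose P j := \prod_(j.+1 <= i < t) y i.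
pose N j : set R := [set x | forall z, ideal_exp I (d.+1 - (t - j)) z ->
                                       H d (y j) (P j * (x * z))].
have [|yt Iyt hyt] := avoid_union R_noetherian R_local m_inf cI.1 (N := N) (t := t).
  move=> j jt; split.
    split=> [z _|c u v hu hv z Iz]; first by rewrite mul0r mulr0; apply: ideal0 (H_ideal _ _).
    have -> : P j * ((c *: (u : R^o) + v) * z) = c * (P j * (u * z)) + P j * (v * z).
      by rewrite /GRing.scale /=; ring.
    by apply: (H_ideal _ _).2; [apply: hu|apply: hv].
  move=> IN; have [z Iz] := hy j jt; apply.
  have e : (d.+1 - (t - j.+1) = (d.+1 - (t - j)).+1)%N by lia.
  move: Iz; rewrite e ideal_expS.
  have : ideal_mul I (ideal_exp I (d.+1 - (t - j))) `<=` colon (H d (y j)) [set P j].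
    apply: ideal_mul_min; first exact: colon_ideal.
    by move=> x w Ix Iw _ ->; rewrite mulrC; apply: IN.
  by move=> h /h /(_ _ erefl); rewrite mulrC.
exists (fun i => if (i == t)%N then yt else y i) => [i|j].
  rewrite ltnS leq_eqVlt; case: eqP => [//|_] /=; exact: Iy.
rewrite ltnS leq_eqVlt => /orP[/eqP->|jt].
  rewrite eqxx big_geq // subnn subn0; apply: contrapT => h; apply: (notH yt Iyt) => z Iz.
  by apply: contrapT => Hz; apply: h; exists z; rewrite ?mul1r.
have := hyt j jt; apply: contra_notP => h z Iz.
apply: contrapT => Hz; apply: h; exists z; first by rewrite subSS.
rewrite ltn_eqF // big_nat_recr //= eqxx.
rewrite (eq_big_nat _ _ (F2 := y)); last by move=> i /andP[_ it]; rewrite ltn_eqF.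
by rewrite -mulrA.
Qed.

(* If no [y] worked, the ideals [H (y i)] of a generic sequence would cut out a
   chain of length [d + 1] between [(a) + b I^(d+1)] and [(a) + I^(d+1)], whereas
   this quotient has length [l(R/(a, b))]. *)
Lemma exists_reduction : exists y d, I y /\
  ideal_exp I d.+1 `<=` ideal_add (elt_mul a setT) (elt_mul y (ideal_exp I d)).
Proof.
pose d := len (ideal2 a b); have iE n := @ideal_exp_ideal _ I n.
have [y Iy yH] : exists2 y, I y & ideal_exp I d.+1 `<=` H d y; last first.
  exists y, d; split=> //; apply: (nakayama R_noetherian R_local (b := b)) => //.
    by apply: ideal_add_ideal; apply: elt_mul_ideal.
  move=> z /yH[u au [_ [v yv [_ [w Iw <-] <-]] <-]]; exists w => //.
  by rewrite addrA addrK; exists u => //; exists v.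
apply: contrapT => notH; have {}notH y : I y -> ~ ideal_exp I d.+1 `<=` H d y.
  by move=> Iy Hy; apply: notH; exists y.
have [y Iy hy] := generic_sequence notH (leqnn _).
set A := ideal_add (elt_mul a setT) (elt_mul b (ideal_exp I d.+1)).
set T := ideal_add (elt_mul a setT) (ideal_exp I d.+1).
have iT : ideal T by apply: ideal_add_ideal => //; apply: elt_mul_ideal.
have iA : ideal A by apply: ideal_add_ideal; apply: elt_mul_ideal.
have AT : A `<=` T.
  apply: ideal_add_sub => //; first by apply: sub_ideal_addl.
  move=> _ [z Iz <-]; apply: sub_ideal_addr; first exact: elt_mul_ideal.
  exact: ideal_mull (iE _) Iz.
have hA : ideal_len setT A (d + len T).
  by apply: len_add_elt_mul => //; apply: m_open_exp.
have [p [q [e /len_eq hp [_ hq]]]] :=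
  haslen_cut iA (@ideal_setT R) iT AT (@subsetT _ _) hA.
apply: hq; have {p q e hp} -> : q = d by lia.
(* Term [j] is cut out by [H d (y i)] for [j <= i <= d], so term [d + 1] is [T]. The product of the
   [y i] with [i > j], times [z], has every such [y i] as a factor but avoids [H d (y j)]; hence
   step [j] is strict. *)
exists (fun j => [set x | T x /\ forall i, (j <= i <= d)%N -> H d (y i) x]).
split=> j jd.
  split; [split=> [|c u v [Tu hu] [Tv hv]]| |by move=> x []].
  - by split=> [|i _]; [exact: ideal0 iT|exact: ideal0 (H_ideal _ _)].
  - by split=> [|i ji]; [apply: iT.2|apply: (H_ideal _ _).2; [apply: hu|apply: hv]].
  - move=> x Ax; split=> [|i _]; first exact: AT.
    case: Ax => u au [w bw <-]; exists u => //; exists w => //.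
    by apply: sub_ideal_addr => //; apply: elt_mul_ideal.
split=> [x [Tx hx]|h].
  by split=> // i /andP[ji id]; apply: hx; rewrite id (ltnW ji).
have [z Iz] := hy j jd; apply.
have Pz i : (j < i <= d)%N -> ideal_exp I d ((\prod_(j.+1 <= k < i) y k) *
    (\prod_(i.+1 <= k < d.+1) y k) * z).
  move=> ji.
  rewrite [X in ideal_exp I X](_ : d =
    (i - j.+1) + (d.+1 - i.+1) + (d.+1 - (d.+1 - j.+1)))%N; last lia.
  rewrite !ideal_expD; do 2!apply: mem_ideal_mul => //.
    by apply: prod_ideal_exp => k k_lt; apply: Iy; lia.
  by apply: prod_ideal_exp => k k_lt; apply: Iy; lia.
suff [_] : [set x | T x /\ forall i, (j <= i <= d)%N -> H d (y i) x]
    ((\prod_(j.+1 <= i < d.+1) y i) * z) by apply; lia.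
apply: h; split=> [|i ji].
  apply: sub_ideal_addr; first exact: elt_mul_ideal.
  rewrite [X in ideal_exp I X](_ : d.+1 = (d.+1 - j.+1) + (d.+1 - (d.+1 - j.+1)))%N;
    last lia.
  rewrite ideal_expD; apply: mem_ideal_mul => //.
  by apply: prod_ideal_exp => k k_lt; apply: Iy; lia.
apply: sub_ideal_addr; first exact: elt_mul_ideal.
apply: sub_ideal_addl; first exact: elt_mul_ideal.
exists ((\prod_(j.+1 <= k < i) y k) * (\prod_(i.+1 <= k < d.+1) y k) * z); first exact: Pz.
rewrite (@big_cat_nat _ _ _ i j.+1 d.+1) /=; [|lia|lia].
by rewrite [X in _ = _ * X * _]big_ltn; [ring|lia].
Qed.

End GenericElement.
End Reduction.

(** * The Hilbert function of two ideals *)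

Section MixedHilbertFunction.
Context {R : comNzRingType} (m : set R).
Hypotheses (R_noetherian : noetherian R) (R_local : local_ring m)
  (CM : cohen_macaulay m) (dim2 : krull_dim R 2).
Implicit Types (I J K A B : set R) (a b p q x y z : R).

Definition mixed_len I J r s := len (mono_ideal I J r s).

Lemma mixed_lenC I J r s : mixed_len I J r s = mixed_len J I s r.
Proof. by rewrite /mixed_len mono_idealC. Qed.

(** For large [k] these are the [c] for which [c t1^k t2^k / (xy)^k] is a Cech boundary. *)
Definition power_sum I J a b k :=
  ideal_add (elt_mul (a ^+ k) (ideal_exp J k)) (elt_mul (b ^+ k) (ideal_exp I k)).

Lemma power_sum_ideal I J a b k : ideal (power_sum I J a b k).
Proof. by apply: ideal_add_ideal; apply: elt_mul_ideal. Qed.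

Lemma power_sum_sub I J a b k : I a -> J b -> power_sum I J a b k `<=` mono_ideal I J k k.
Proof.
move=> Ia Jb; apply: ideal_add_sub => // _ [z z_in <-].
  by apply: mem_ideal_mul => //; apply: mem_ideal_exp.
by rewrite mulrC; apply: mem_ideal_mul => //; apply: mem_ideal_exp.
Qed.

(** Koszul formula for [a^k], [b^k], [J^k], [I^k]: both colon ideals are [R], because [b^k] lies in
    [J^k] and [a^k] in [I^k]. *)
Lemma haslen_power_sum I J a b k : m_open m I -> m_open m J -> I a -> J b ->
    m_open m (ideal2 a b) ->
  exists2 g, ideal_len (mono_ideal I J k k) (power_sum I J a b k) g &
    (g + mixed_len I J k k =
     k * k * len (ideal2 a b) + mixed_len I J k 0 + mixed_len I J 0 k)%N.
Proof.
move=> cI cJ Ia Jb cab; have iM := power_sum_ideal I J a b k.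
have [d hd] := len_koszul R_noetherian R_local CM dim2 (m_open_ideal2X k k cab)
  (m_open_exp k cJ) (m_open_exp k cI).
have -> : colon (ideal_exp J k) [set b ^+ k] `&` colon (ideal_exp I k) [set a ^+ k] = setT.
  apply/seteqP; split=> // z _; split=> _ ->;
    by apply: ideal_mull => //; apply: mem_ideal_exp.
rewrite len_setT addn0 (len_ideal2X R_noetherian R_local CM dim2) //.
have [p [q [-> /len_eq <- hq]]] :=
  haslen_cut iM (@ideal_setT R) (@mono_ideal_ideal R I J k k) (power_sum_sub Ia Jb)
    (@subsetT _ _) hd.
move=> e; exists q => //.
rewrite /mixed_len mono_ideal0l mono_ideal0r; lia.
Qed.

(** From [a b c = a^(k+1) u + b^(k+1) v], exactness for [(a, b^(k+1))] gives [v = w a], and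
    exactness for [(a^k, b)] then makes [u] a multiple of [b]. The colon hypotheses place the two
    cofactors in [I^k] and [J^k]. *)
Lemma power_sum_saturated I J a b k c :
    m_open m (ideal2 a b) ->
    colon (ideal_exp I k.+1) [set a] `<=` ideal_exp I k ->
    colon (ideal_exp J k.+1) [set b] `<=` ideal_exp J k ->
  power_sum I J a b k.+1 (a * b * c) -> power_sum I J a b k c.
Proof.
move=> cab hI hJ [_ [u Ju <-] [_ [v Iv <-] e]].
have kab i j : koszul_exact (a ^+ i) (b ^+ j).
  apply: (m_open_koszul_exact CM dim2).
  exact: m_open_ideal2X.
have [|w [ew ev]] := kab 1%N k.+1 (b * c - a ^+ k * u) (- v).
  rewrite expr1 mulrN mulrBr mulrA [a * (_ * u)]mulrA -exprS -e; ring.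
rewrite expr1 in ev; move/oppr_inj: ev => ev.
have Iw : ideal_exp I k w by apply: hI => _ ->; rewrite -ev.
have [|w' [ew' eu]] := kab k 1%N (- u) (c - b ^+ k * w).
  rewrite expr1 mulrN mulrBr [b * (_ * w)]mulrA -exprS [_ * w]mulrC -ew; ring.
have {}eu : c = a ^+ k * (- w') + b ^+ k * w.
  by rewrite -[LHS](subrK (b ^+ k * w)) eu; ring.
rewrite expr1 in ew'.
have Jw' : ideal_exp J k (- w').
  by apply: hJ => _ ->; rewrite mulNr -ew' opprK.
by rewrite eu; exists (a ^+ k * - w'); [exists (- w')|exists (b ^+ k * w) => //; exists w].
Qed.

Definition M1_denom I J a b r s :=
  ideal_add (elt_mul a (mono_ideal I J r s.+1)) (elt_mul b (mono_ideal I J r.+1 s)).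

Lemma M1_denom_sub I J a b r s : I a -> J b ->
  M1_denom I J a b r s `<=` mono_ideal I J r.+1 s.+1.
Proof.
move=> Ia Jb; apply: ideal_add_sub => // _ [z z_in <-].
  by rewrite mono_idealSl; apply: mem_ideal_mul.
by rewrite mono_idealSr; apply: mem_ideal_mul.
Qed.

(** The intersection of the two colon ideals always contains [I^r J^s]; either Rees condition alone
    forces equality, which is why a large [r] or a large [s] suffices. *)
Lemma haslen_M1 I J a b r s : m_open m I -> m_open m J -> I a -> J b ->
    m_open m (ideal2 a b) ->
    colon (mono_ideal I J r.+1 s) [set a] `<=` mono_ideal I J r s \/
    colon (mono_ideal I J r s.+1) [set b] `<=` mono_ideal I J r s ->
  exists2 n, ideal_len (mono_ideal I J r.+1 s.+1) (M1_denom I J a b r s) n &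
   (n + mixed_len I J r.+1 s.+1 + mixed_len I J r s =
    len (ideal2 a b) + mixed_len I J r.+1 s + mixed_len I J r s.+1)%N.
Proof.
move=> cI cJ Ia Jb cab rees.
have cE i j := m_open_mono i j cI cJ.
have iM : ideal (M1_denom I J a b r s) by apply: ideal_add_ideal; apply: elt_mul_ideal.
have [d hd] := len_koszul R_noetherian R_local CM dim2 cab (cE r s.+1) (cE r.+1 s).
have -> : colon (mono_ideal I J r s.+1) [set b] `&` colon (mono_ideal I J r.+1 s) [set a] =
    mono_ideal I J r s.
  apply/seteqP; split=> [z [zb za]|z hz]; first by case: rees; apply.
  by split=> _ ->; rewrite mulrC ?mono_idealSl ?mono_idealSr; apply: mem_ideal_mul.
have [p [q [-> /len_eq <- hq]]] :=
  haslen_cut iM (@ideal_setT R) (@mono_ideal_ideal R I J r.+1 s.+1) (M1_denom_sub Ia Jb)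
    (@subsetT _ _) hd.
move=> e; exists q => //; rewrite /mixed_len; lia.
Qed.

(** By the Rees condition the first difference in [r] is [W], the colength modulo [a]. A reduction
    [y] modulo [a] makes [W] grow by [l(R/(a, y))] at each step. Neither this constant nor the
    threshold depends on [s]. *)
Lemma mixed_len_diff2 I J a b N : infinite_residue_field m ->
    m_open m I -> m_open m J -> I a -> J b -> m b -> m_open m (ideal2 a b) ->
    (forall r s, (N <= r)%N ->
       colon (mono_ideal I J r.+1 s) [set a] `<=` mono_ideal I J r s) ->
  exists al N', forall r s, (N' <= r)%N ->
    (mixed_len I J r.+2 s + mixed_len I J r s = (mixed_len I J r.+1 s).*2 + al)%N.
Proof.
move=> m_inf cI cJ Ia Jb mb cab rees.
have [y [d [Iy red]]] :=
  exists_reduction R_noetherian R_local CM dim2 m_inf cI mb cab.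
have cay : m_open m (ideal2 a y).
  apply: m_open_sub (m_open_exp d.+1 cI); first exact: ideal2_ideal.
  apply: subset_trans red _; apply: ideal_add_sub; first exact: ideal2_ideal.
    exact/sub_ideal_addl/elt_mul_ideal.
  move=> _ [z _ <-]; apply: sub_ideal_addr; first exact: elt_mul_ideal.
  by exists z.
pose W r s := len (ideal_add (elt_mul a setT) (mono_ideal I J r s)).
have stepV r s : (N <= r)%N -> mixed_len I J r.+1 s = (W r.+1 s + mixed_len I J r s)%N.
  move=> Nr; rewrite /mixed_len (len_colon R_noetherian R_local a); last exact: m_open_mono.
  congr (_ + len _)%N; apply/seteqP; split; first exact: rees.
  by move=> z hz _ ->; rewrite mulrC mono_idealSl; apply: mem_ideal_mul.
have iaT : ideal (elt_mul a setT) by apply: elt_mul_ideal.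
have stepW r s : (d <= r)%N -> W r.+1 s = (len (ideal2 a y) + W r s)%N.
  move=> dr; rewrite /W.
  rewrite -(len_eq (len_add_elt_mul R_noetherian R_local CM dim2 cay (m_open_mono r s cI cJ))).
  have iay : ideal (ideal_add (elt_mul a setT) (elt_mul y (mono_ideal I J r s))).
    by apply: ideal_add_ideal => //; apply: elt_mul_ideal.
  congr len; apply/seteqP; split; last first.
    apply: ideal_add_sub; first exact: ideal_add_ideal.
      exact: sub_ideal_addl.
    move=> _ [z hz <-]; apply: sub_ideal_addr => //.
    by rewrite mono_idealSl; apply: mem_ideal_mul.
  apply: ideal_add_sub => //; first exact/sub_ideal_addl/elt_mul_ideal.
  have -> : mono_ideal I J r.+1 s = ideal_mul (ideal_exp I d.+1) (mono_ideal I J (r - d) s).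
    by rewrite /mono_ideal ideal_mulA -ideal_expD; congr (ideal_mul (ideal_exp I _) _); lia.
  apply: ideal_mul_min => // x z /red[_ [u _ <-] [_ [v Iv <-] <-]] hz.
  rewrite mulrDl; exists (a * u * z); first by exists (u * z); rewrite // mulrA.
  exists (y * v * z) => //; exists (v * z); last by rewrite mulrA.
  have -> : mono_ideal I J r s = ideal_mul (ideal_exp I d) (mono_ideal I J (r - d) s).
    by rewrite /mono_ideal ideal_mulA -ideal_expD; congr (ideal_mul (ideal_exp I _) _); lia.
  exact: mem_ideal_mul.
exists (len (ideal2 a y)), (maxn N d) => r s hr.
rewrite !stepV ?(stepW r.+1); lia.
Qed.

End MixedHilbertFunction.

(** * The second local cohomology module *)

Section LaurentMonomials.
Context {R : comNzRingType}.
Implicit Types (I J K : set R) (c z : R).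

Lemma lmonomD c c' d : lmonom (c + c') d = lmonom c d + lmonom c' d :> laurent R.
Proof. exact: monalgUD. Qed.

Lemma lmonomZ c c' d : lmonom (c * c') d = c *: lmonom c' d :> laurent R.
Proof. by apply/malgP => e; rewrite mcoeffZ !mcoeffU mulrnAr. Qed.

Lemma lmonom_mul c c' d d' :
  lmonom c d * lmonom c' d' = lmonom (c * c') (d + d') :> laurent R.
Proof. exact: lmonomM. Qed.

Lemma lmonom_exp c d n : lmonom c d ^+ n = lmonom (c ^+ n) (d *+ n) :> laurent R.
Proof.
elim: n => [|n IH]; first by rewrite !expr0 mulr0n.
by rewrite !exprS IH lmonom_mul mulrS.
Qed.

Lemma mcoeff_lmonom_mul c d (f : laurent R) e :
  mcoeff (d + e) (lmonom c d * f) = c * mcoeff e f.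
Proof.
rewrite [in LHS](laurentE f) mulr_sumr [in RHS](laurentE f) !raddf_sum mulr_sumr /=.
by apply: eq_bigr => d' _; rewrite lmonom_mul !mcoeffU (inj_eq (addrI d)) mulrnAr.
Qed.

Lemma mem_ideal_expzS K c z n : K c -> ideal_expz K n z -> ideal_expz K (n + 1) (c * z).
Proof.
(* For negative [n] the exponent [n + 1] is at most [0], so the target is all of [R]. *)
case: n => [n|[|n]] Kc hz //.
by rewrite (_ : n%:Z + 1 = n.+1%:Z); [apply: mem_ideal_mul|lia].
Qed.

Lemma ideal_exp2_ideal I J r s : ideal (ideal_exp2 I J r s).
Proof. exact: ideal_mul_ideal. Qed.

Lemma ideal_exp2C I J r s : ideal_exp2 I J r s = ideal_exp2 J I s r.
Proof. exact: ideal_mulC. Qed.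

Lemma mem_ideal_exp2S I J c z r s :
  I c -> ideal_exp2 I J r s z -> ideal_exp2 I J (r + 1) s (c * z).
Proof.
move=> Ic; apply: (ideal_mul_min (K := [set z | ideal_exp2 I J (r + 1) s (c * z)])).
  split=> [|d u v hu hv]; first by rewrite /= mulr0; exact: ideal0 (ideal_exp2_ideal _ _ _ _).
  rewrite /= (_ : c * (d *: (u : R^o) + v) = d * (c * u) + c * v); last first.
    by rewrite /GRing.scale /=; ring.
  exact: (ideal_exp2_ideal _ _ _ _).2.
by move=> u v Iu Jv; rewrite /= mulrA; apply: mem_ideal_mul => //; apply: mem_ideal_expzS.
Qed.

Lemma ext_rees_submod I J : submod (ext_rees I J).
Proof.
split=> [r s|c f g hf hg r s].
  by rewrite mcoeff0; exact: ideal0 (ideal_exp2_ideal _ _ _ _).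
rewrite mcoeffD mcoeffZ; exact: (ideal_exp2_ideal _ _ _ _).2.
Qed.

Lemma ext_rees_lmonom I J c r s : ext_rees I J (lmonom c (r, s)) <-> ideal_exp2 I J r s c.
Proof.
split=> [/(_ r s)|hc r' s']; first by rewrite mcoeffUU.
rewrite mcoeffU; case: eqP => [[<- <-] //|_].
by rewrite mulr0n; exact: ideal0 (ideal_exp2_ideal _ _ _ _).
Qed.

Lemma ext_rees_mul_lmonom10 I J c f : I c -> ext_rees I J f ->
  ext_rees I J (lmonom c (1, 0) * f).
Proof.
move=> Ic hf r s; have -> : (r, s) = ((1, 0) + (r - 1, s) : int * int).
  by congr pair => /=; lia.
rewrite mcoeff_lmonom_mul -[r in ideal_exp2 _ _ r](subrK 1).
exact: mem_ideal_exp2S (hf _ _).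
Qed.

Lemma ext_rees_mul_lmonom01 I J c f : J c -> ext_rees I J f ->
  ext_rees I J (lmonom c (0, 1) * f).
Proof.
move=> Jc hf r s; have -> : (r, s) = ((0, 1) + (r, s - 1) : int * int).
  by congr pair => /=; lia.
rewrite mcoeff_lmonom_mul -[s in ideal_exp2 _ _ _ s](subrK 1) ideal_exp2C.
by apply: mem_ideal_exp2S => //; rewrite ideal_exp2C.
Qed.

End LaurentMonomials.

(** * Boundaries in the Cech complex *)

Section CechBoundary.
Context {R : comNzRingType} {L : comAlgType R} (S : set L) (x y : L).
Hypotheses (S_submod : submod S) (Sx : forall f, S f -> S (x * f))
  (Sy : forall f, S f -> S (y * f)).

Local Notation fr := (@Defs.frac R L (x * y)).

Let SxX f n : S f -> S (x ^+ n * f).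
Proof.
by move=> Sf; elim: n => [|n IH]; [rewrite mul1r|rewrite exprS -mulrA; apply: Sx].
Qed.

Let SyX f n : S f -> S (y ^+ n * f).
Proof.
by move=> Sf; elim: n => [|n IH]; [rewrite mul1r|rewrite exprS -mulrA; apply: Sy].
Qed.

Lemma frac_expandS f k : fr (x * y * f) k.+1 = fr f k.
Proof. by rewrite -[RHS](frac_expand (x * y) 1) expr1. Qed.

Lemma cech2_boundP z : cech2_bound S x y z <->
  exists u v k, [/\ S u, S v & z = fr (y ^+ k * u + x ^+ k * v) k].
Proof.
split=> [[_ [u Su [k _ <-]] [_ [v Sv [l _ <-]] <-]]|[u [v [k [Su Sv ->]]]]].
  exists (x ^+ l * u), (y ^+ k * v), (l + k)%N; split; [exact: SxX|exact: SyX|].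
  rewrite -[fr _ k](frac_expand (x * y) l) -[fr _ l](frac_expand (x * y) k).
  rewrite (addnC k l) [LHS]loc_addE; congr (fr _ _).
  by rewrite !exprMn !exprD; ring.
exists (fr (y ^+ k * u) k); first by exists u => //; exists k.
exists (fr (x ^+ k * v) k); first by exists v => //; exists k.
exact: loc_addE.
Qed.

Lemma cech2_bound_submod : submod (cech2_bound S x y).
Proof.
split.
  apply/cech2_boundP; exists 0, 0, 0%N; split; [exact: S_submod.1|exact: S_submod.1|].
  by rewrite !mulr0 addr0.
move=> c _ _ /cech2_boundP[u [v [k [Su Sv ->]]]] /cech2_boundP[u' [v' [l [Su' Sv' ->]]]].
apply/cech2_boundP; exists (c *: (x ^+ l * u) + x ^+ k * u').
exists (c *: (y ^+ l * v) + y ^+ k * v'), (l + k)%N.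
split; [by apply: S_submod.2; apply: SxX|by apply: S_submod.2; apply: SyX|].
rewrite -[fr _ k](frac_expand (x * y) l) -[fr _ l](frac_expand (x * y) k).
rewrite (addnC k l) [_ *: _]loc_scaleE [LHS]loc_addE; congr (fr _ _).
rewrite !mulrDr -!scalerAr !exprMn !exprD scalerDr.
have -> : x ^+ l * y ^+ l * (y ^+ k * u) = y ^+ l * y ^+ k * (x ^+ l * u) by ring.
have -> : x ^+ l * y ^+ l * (x ^+ k * v) = x ^+ l * x ^+ k * (y ^+ l * v) by ring.
have -> : x ^+ k * y ^+ k * (y ^+ l * u') = y ^+ l * y ^+ k * (x ^+ k * u') by ring.
have -> : x ^+ k * y ^+ k * (x ^+ l * v') = x ^+ l * x ^+ k * (y ^+ k * v') by ring.
exact: addrACA.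
Qed.

End CechBoundary.

Section SecondLocalCohomology.
Context {R : comNzRingType} (I J : set R) (a b : R).
Hypotheses (Ia : I a) (Jb : J b).

Local Notation x := (lmonom a (1, 0) : laurent R).
Local Notation y := (lmonom b (0, 1) : laurent R).
Local Notation S := (ext_rees I J).
Local Notation fr := (@Defs.frac R (laurent R) (x * y)).

Let bound := cech2_bound S x y.

Let boundP z : bound z <->
  exists u v k, [/\ S u, S v & z = fr (y ^+ k * u + x ^+ k * v) k].
Proof.
by apply: cech2_boundP => f; [apply: ext_rees_mul_lmonom10|apply: ext_rees_mul_lmonom01].
Qed.

Let bound_submod : submod bound.
Proof.
apply: cech2_bound_submod; first exact: ext_rees_submod.
  by move=> f; apply: ext_rees_mul_lmonom10.
by move=> f; apply: ext_rees_mul_lmonom01.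
Qed.

(** A fraction of degree [(0, 0)] over [(xy)^k] has a numerator of degree [(k, k)]. *)
Let stage k c : loc (x * y) := fr (lmonom c (k%:Z, k%:Z)) k.

Let stage_lin k : linear (stage k : R^o -> loc (x * y)).
Proof.
move=> c u v; rewrite /stage lmonomD lmonomZ.
by rewrite [_ *: fr _ _]loc_scaleE [RHS]loc_addE.
Qed.

Let xyE : x * y = lmonom (a * b) (1, 1) :> laurent R.
Proof. by rewrite lmonom_mul. Qed.

Let diag i : int * int := (i%:Z, i%:Z).

Let diagE i : (1, 1) *+ i = diag i.
Proof. by rewrite pairMnE /= natz. Qed.

Let diagD i j : diag (i + j)%N = diag i + diag j.
Proof. by []. Qed.

Let diagY i : (0, 1) *+ i + (i%:Z, 0) = diag i.
Proof. by rewrite pairMnE /= mul0rn natz -[LHS]/(0 + i%:Z, i%:Z + 0) add0r addr0. Qed.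

Let diagX i : (1, 0) *+ i + (0, i%:Z) = diag i.
Proof. by rewrite pairMnE /= mul0rn natz -[LHS]/(i%:Z + 0, 0 + i%:Z) add0r addr0. Qed.

Let x_power i c : x ^+ i * lmonom c (0, i%:Z) = lmonom (a ^+ i * c) (diag i).
Proof. by rewrite lmonom_exp lmonom_mul diagX. Qed.

Let y_power i c : y ^+ i * lmonom c (i%:Z, 0) = lmonom (b ^+ i * c) (diag i).
Proof. by rewrite lmonom_exp lmonom_mul diagY. Qed.

Let mcoeff_x_power i (f : laurent R) :
  mcoeff (diag i) (x ^+ i * f) = a ^+ i * mcoeff (0, i%:Z) f.
Proof. by rewrite lmonom_exp -diagX; apply: mcoeff_lmonom_mul. Qed.

Let mcoeff_y_power i (f : laurent R) :
  mcoeff (diag i) (y ^+ i * f) = b ^+ i * mcoeff (i%:Z, 0) f.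
Proof. by rewrite lmonom_exp -diagY; apply: mcoeff_lmonom_mul. Qed.

Let xy_power i : (x * y) ^+ i = lmonom ((a * b) ^+ i) (diag i).
Proof. by rewrite xyE lmonom_exp diagE. Qed.

Let mcoeff_xy_power i j (f : laurent R) :
  mcoeff (diag (i + j)) ((x * y) ^+ i * f) = (a * b) ^+ i * mcoeff (diag j) f.
Proof. by rewrite xy_power diagD; apply: mcoeff_lmonom_mul. Qed.

(** Passing to the next denominator is multiplication by [a b]. *)
Let stageS k c : stage k.+1 (a * b * c) = stage k c.
Proof.
have E : lmonom (a * b * c) (diag k.+1) = x * y * lmonom c (diag k).
  by rewrite xyE lmonom_mul.
rewrite /stage -/(diag k) -/(diag k.+1) E; exact: frac_expandS.
Qed.

Section Stages.
Variable N : nat.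
Hypothesis saturated : forall k, (N <= k)%N -> forall c,
  power_sum I J a b k.+1 (a * b * c) -> power_sum I J a b k c.

Let power_sum_saturatedX k j c : (N <= k)%N ->
  power_sum I J a b (k + j) ((a * b) ^+ j * c) -> power_sum I J a b k c.
Proof.
move=> Nk; elim: j => [|j IH]; first by rewrite mul1r addn0.
by rewrite addnS exprS -mulrA => /(saturated (leq_trans Nk (leq_addr _ _)))/IH.
Qed.

Let bound_stage k c : (N <= k)%N -> bound (stage k c) <-> power_sum I J a b k c.
Proof.
move=> Nk; split; last first.
  case=> [_ [u Ju <-] [_ [v Iv <-] <-]]; apply/boundP.
  exists (lmonom v (k%:Z, 0)), (lmonom u (0, k%:Z)), k; split.
  - by apply/ext_rees_lmonom; rewrite ideal_exp2E mono_ideal0l.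
  - by apply/ext_rees_lmonom; rewrite ideal_exp2E mono_ideal0r.
  have E : lmonom (b ^+ k * v + a ^+ k * u) (diag k) =
      y ^+ k * lmonom v (k%:Z, 0) + x ^+ k * lmonom u (0, k%:Z).
    exact: etrans (lmonomD _ _ _) (esym (f_equal2 +%R (y_power k v) (x_power k u))).
  rewrite [a ^+ k * u + _]addrC; exact: (congr1 (fun f => fr f k) E).
move=> /boundP[u [v [K [Su Sv]]]] /eq_frac[n].
(* Only the coefficients of [u] in degree [(K, 0)] and of [v] in degree [(0, K)] enter here. They
   lie in [I^K] and [J^K], which puts [(a b)^(n+K) c] in the power sum of index [k + n + K];
   saturation then cancels [(a b)^(n+K)]. *)
move/(congr1 (mcoeff (diag (n + K + k)%N))).
rewrite mcoeff_xy_power mcoeffUU addnAC mcoeff_xy_power mcoeffD.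
rewrite mcoeff_x_power mcoeff_y_power.
move: (Su K%:Z 0) (Sv 0 K%:Z); rewrite !ideal_exp2E mono_ideal0l mono_ideal0r.
move: (mcoeff _ u) (mcoeff _ v) => u0 v0 Iu Jv e.
apply: (power_sum_saturatedX (j := (n + K)%N)) => //; rewrite e.
have -> : (a * b) ^+ (n + k) * (b ^+ K * u0 + a ^+ K * v0) =
    a ^+ (k + (n + K)) * (b ^+ (n + k) * v0) + b ^+ (k + (n + K)) * (a ^+ (n + k) * u0).
  by rewrite !exprD !exprMn; ring.
have -> : (k + (n + K) = n + k + K)%N by lia.
exists (a ^+ (n + k + K) * (b ^+ (n + k) * v0)).
  exists (b ^+ (n + k) * v0) => //; rewrite ideal_expD.
  by apply: mem_ideal_mul => //; apply: mem_ideal_exp.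
exists (b ^+ (n + k + K) * (a ^+ (n + k) * u0)) => //.
exists (a ^+ (n + k) * u0) => //; rewrite ideal_expD.
by apply: mem_ideal_mul => //; apply: mem_ideal_exp.
Qed.

Let C := @cech2_comp R I J a b (0, 0).

(** Modulo [bound] these are submodules of [[H^2]_(0,0)], increasing with union the whole module. *)
Let stages k := set_add bound ((stage k : R^o -> _) @` mono_ideal I J k k).

Let stage_im_submod k : submod ((stage k : R^o -> _) @` mono_ideal I J k k).
Proof. exact: (submod_im (stage_lin k) (@mono_ideal_ideal R I J k k)). Qed.

Let stages_submod k : submod (stages k).
Proof. exact: submod_add bound_submod (stage_im_submod k). Qed.

Let sub_bound_stages k : bound `<=` stages k.
Proof. exact: sub_set_addl. Qed.

Let mem_stages k c : mono_ideal I J k k c -> stages k (stage k c).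
Proof. by move=> hc; apply: sub_set_addr => //; exists c. Qed.

Let stages_incr k : stages k `<=` stages k.+1.
Proof.
apply: set_add_sub => // _ [c hc <-]; rewrite -stageS; apply: mem_stages.
rewrite mono_idealSl mono_idealSr -mulrA.
by apply: mem_ideal_mul => //; apply: mem_ideal_mul.
Qed.

Let stages_le k l : (k <= l)%N -> stages k `<=` stages l.
Proof.
elim: l => [|l IH]; first by rewrite leqn0 => /eqP-> z.
rewrite leq_eqVlt => /orP[/eqP-> z //|/IH h]; exact: subset_trans h (@stages_incr l).
Qed.

Let stages_sub k : stages k `<=` set_add bound C.
Proof.
move=> _ [z Bz [_ [c hc <-] <-]]; exists z => //; exists (stage k c) => //.
by exists c, k; rewrite /= !add0r; split=> //; apply/ext_rees_lmonom.
Qed.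

Let sub_stages z : set_add bound C z -> exists k, stages k z.
Proof.
move=> [w Bw [_ [c [k [/= hc ->]]] <-]]; exists k; exists w => //.
exists (stage k c); last by rewrite /stage !add0r.
by exists c => //; move: hc; rewrite !add0r => /ext_rees_lmonom.
Qed.

Variable g : nat -> nat.
Hypothesis haslen_g : forall k, (N <= k)%N ->
  ideal_len (mono_ideal I J k k) (power_sum I J a b k) (g k).

Let haslen_stages k : (N <= k)%N -> haslen (stages k) bound (g k).
Proof.
move=> Nk; apply: (iffLR (haslen_transfer (stage_lin k)
  (@mono_ideal_ideal R I J k k) bound_submod (@stages_submod k)
  (power_sum_sub (k := k) Ia Jb) (@sub_bound_stages k) (@mem_stages k) _ _ (g k))
  (haslen_g Nk)).
  by move=> _ [w Bw [_ [c hc <-] <-]]; exists c => //; rewrite addrK.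
by move=> c _; apply: bound_stage.
Qed.

Lemma length_H2_finite : (length_H2 I J a b (0%R, 0%R) < +oo)%E ->
  exists n, forall k, (N <= k)%N -> (g k <= n)%N.
Proof.
move=> /length_fin[n hn]; exists n => k Nk; apply: (haslen_le hn).
exact: has_chain_sub (@stages_sub k) (haslen_stages Nk).1.
Qed.

(** Equal lengths force consecutive stages to coincide, so the union is already reached at stage
    [N]. *)
Lemma length_H2_const n : (forall k, (N <= k)%N -> g k = n) ->
  length_H2 I J a b (0, 0) = n%:Z%:E.
Proof.
move=> gn; apply/haslenP; rewrite -/bound -/C.
have stagesE k : (N <= k)%N -> stages k.+1 = stages k.
  move=> Nk; have hk := haslen_stages Nk; have hk1 := haslen_stages (leqW Nk).
  have [p [q [e hp hq]]] := haslen_cut bound_submod (stages_submod _) (stages_submod k)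
    (@sub_bound_stages k) (@stages_incr k) hk1.
  have eq := haslen_uniq hq hk; rewrite !gn // in e eq; last exact: leqW.
  have p0 : p = 0%N by lia.
  rewrite p0 in hp; apply/esym/(haslen0 _ _ (@stages_incr k)) => //; exact: stages_submod.
have stagesN j : stages (N + j) = stages N.
  by elim: j => [|j IH]; rewrite ?addn0 // addnS stagesE ?leq_addr.
have -> : set_add bound C = stages N.
  apply/seteqP; split; last exact: stages_sub.
  move=> z /sub_stages[k hz]; rewrite -(stagesN k).
  by apply: stages_le hz; apply: leq_addl.
by rewrite -(gn N) //; apply: haslen_stages.
Qed.

End Stages.
End SecondLocalCohomology.

(** * Hilbert polynomials *)

Section QuadraticSequences.
Implicit Types (al be c d p q : int) (N n r s : nat).

Lemma bin2Z n : ('C(n.+2, 2)%:Z = 'C(n.+1, 2)%:Z + n%:Z + 1)%R.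
Proof. by rewrite binS bin1; lia. Qed.

Lemma bin2_square n : (n%:Z * n%:Z = 2 * 'C(n.+1, 2)%:Z - n%:Z)%R.
Proof. by elim: n => [//|n IH]; rewrite bin2Z intS; lia. Qed.

Lemma quadratic_of_diff2 (f : nat -> int) al N :
    (forall n, (N <= n)%N -> f n.+2 + f n = f n.+1 *+ 2 + al) ->
  exists p q, forall n, (N <= n)%N -> f n = al * 'C(n.+1, 2)%:Z - p * n%:Z + q.
Proof.
(* The first difference of [al C(n+1, 2) - p n] at [N] is [al (N + 1) - p]; this choice of [p]
   matches it with that of [f]. *)
move=> hf; pose p := al * N.+1%:Z - (f N.+1 - f N).
exists p, (f N - al * 'C(N.+1, 2)%:Z + p * N%:Z) => n /subnKC <-.
suff : f (N + (n - N))%N = al * 'C((N + (n - N)).+1, 2)%:Z - p * (N + (n - N))%N%:Z +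
         (f N - al * 'C(N.+1, 2)%:Z + p * N%:Z) /\
       f (N + (n - N)).+1 = al * 'C((N + (n - N)).+2, 2)%:Z - p * (N + (n - N)).+1%:Z +
         (f N - al * 'C(N.+1, 2)%:Z + p * N%:Z) by case.
elim: (n - N)%N => [|k [IH1 IH2]].
  by rewrite addn0 bin2Z /p !intS; split; ring.
rewrite addnS; split=> //.
have := hf (N + k)%N (leq_addr _ _); rewrite IH1 IH2 => /(canRL (addrK _)) ->.
rewrite !bin2Z !intS; ring.
Qed.

Lemma quadratic_inj e0 e1 e2 e0' e1' e2' N :
    (forall n, (N <= n)%N ->
       e0 * 'C(n.+1, 2)%:Z - e1 * n%:Z + e2 =
       e0' * 'C(n.+1, 2)%:Z - e1' * n%:Z + e2' :> int) ->
  [/\ e0 = e0', e1 = e1' & e2 = e2'].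
Proof.
move=> h; have h0 := h N (leqnn _); have h1 := h N.+1 (leqW (leqnn _)).
have h2 := h N.+2 (leqW (leqW (leqnn _))).
rewrite !bin2Z !intS in h1 h2; rewrite ?intS in h0.
have e : e0 = e0' by lia.
subst e0'; have e : e1 = e1' by lia.
by subst e1'; split=> //; lia.
Qed.

(* The closed form of [l(R / I^r J^s)] for large [r] and [s]. *)
Definition mixed_quadratic (e : nat) al be c1 c2 c0 r s : int :=
  e%:Z * r%:Z * s%:Z + al * 'C(r.+1, 2)%:Z + be * 'C(s.+1, 2)%:Z
  - c1 * r%:Z - c2 * s%:Z + c0.

(** The edges [v r N] and [v N s] are quadratic, and the constant mixed difference fills the
    quadrant with the extra term [e (r - N) (s - N)], whose expansion shifts the lower
    coefficients. *)
Lemma mixed_quadratic_of_diff2 (v : nat -> nat -> int) (e : nat) al be N :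
    (forall r, (N <= r)%N -> v r.+2 N + v r N = v r.+1 N *+ 2 + al) ->
    (forall s, (N <= s)%N -> v N s.+2 + v N s = v N s.+1 *+ 2 + be) ->
    (forall r s, (N <= r)%N -> (N <= s)%N ->
       v r.+1 s.+1 + v r s = e%:Z + v r.+1 s + v r s.+1) ->
  exists c1 c2 c0, forall r s, (N <= r)%N -> (N <= s)%N ->
    v r s = mixed_quadratic e al be c1 c2 c0 r s.
Proof.
move=> /(quadratic_of_diff2 (f := v^~ N))[p1 [p0 hp]].
move=> /(quadratic_of_diff2 (f := v N))[q1 [q0 hq]] hm.
have col r j : (N <= r)%N ->
    v r.+1 (N + j)%N - v r (N + j)%N = v r.+1 N - v r N + e%:Z * j%:Z.
  move=> Nr; elim: j => [|j IH]; first by rewrite addn0; ring.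
  have := hm r (N + j)%N Nr (leq_addr _ _); rewrite addnS intS; lia.
have grid i j : v (N + i)%N (N + j)%N =
    v (N + i)%N N + v N (N + j)%N - v N N + e%:Z * i%:Z * j%:Z.
  elim: i => [|i IH]; first by rewrite addn0; ring.
  have := col (N + i)%N j (leq_addr _ _); rewrite addnS intS; lia.
exists (p1 + e%:Z * N%:Z), (q1 + e%:Z * N%:Z), (p0 + q0 - v N N + e%:Z * N%:Z * N%:Z).
move=> r s Nr Ns; have := grid (r - N)%N (s - N)%N; rewrite !subnKC // => ->.
rewrite hp // (hq s) // -!subzn // /mixed_quadratic; ring.
Qed.

Lemma mixed_quadratic_inj (e e' : int) al al' be be' c1 c1' c2 c2' c0 c0' N :
    (forall r s, (N <= r)%N -> (N <= s)%N ->
       e * r%:Z * s%:Z + al * 'C(r.+1, 2)%:Z + be * 'C(s.+1, 2)%:Z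
         - c1 * r%:Z - c2 * s%:Z + c0 =
       e' * r%:Z * s%:Z + al' * 'C(r.+1, 2)%:Z + be' * 'C(s.+1, 2)%:Z
         - c1' * r%:Z - c2' * s%:Z + c0') ->
  c1 = c1' /\ c2 = c2'.
Proof.
move=> h; pose N0 := leqnn N; pose N1 := leqW N0; pose N2 := leqW N1.
have h00 := h N N N0 N0; have h10 := h N.+1 N N1 N0; have h20 := h N.+2 N N2 N0.
have h01 := h N N.+1 N0 N1; have h02 := h N N.+2 N0 N2; have h11 := h N.+1 N.+1 N1 N1.
rewrite !bin2Z !intS in h10 h20 h01 h02 h11.
have E : e = e' by lia.
subst e'; have E : al = al' by lia.
subst al'; have E : be = be' by lia.
by subst be'; split; lia.
Qed.

(** The mixed differences telescope in [r], leaving first differences in [s] along the columns [r]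
    and [0]. *)
Lemma sum_mixed_diff (v : nat -> nat -> int) (mu : nat -> nat) (e : nat) r s :
    (forall i, (i < r)%N ->
       (mu i)%:Z + v i.+1 s.+1 + v i s = e%:Z + v i.+1 s + v i s.+1) ->
  (\sum_(i < r) mu i)%N%:Z = e%:Z * r%:Z + v r s - v r s.+1 - v 0%N s + v 0%N s.+1.
Proof.
elim: r => [|r IH] h; first by rewrite big_ord0; ring.
rewrite big_ord_recr /= PoszD IH => [|i ir]; last by apply: h; apply: leqW.
have := h r (ltnSn r); rewrite intS; lia.
Qed.

End QuadraticSequences.

Section HilbertCoefficients.
Context {R : comNzRingType}.
Implicit Types (I J K : set R).

(** The definition selects an arbitrary fitting triple; [quadratic_inj] makes the choice
    immaterial. *)
Lemma hilbert_coef_eq K (p0 p1 p2 : int) N :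
    (forall n, (N <= n)%N ->
       colength (ideal_exp K n) = (p0 * 'C(n.+1, 2)%:Z - p1 * n%:Z + p2)%:E) ->
  hilbert_coef K 1 = p1 /\ hilbert_coef K 2 = p2.
Proof.
move=> h; rewrite /hilbert_coef; case: xgetP => [f _ [N' hf]|].
  have [n|//] := @quadratic_inj (f 0%N) (f 1%N) (f 2%N) p0 p1 p2 (maxn N N').
  rewrite geq_max => /andP[Nn N'n].
  by have [] := etrans (esym (hf n N'n)) (h n Nn).
by move/(_ (nth 0 [:: p0; p1; p2])) => []; exists N.
Qed.

Lemma bihilbert_sumE (e : nat -> nat -> int) r s :
  \sum_(i < 3) \sum_(j < 3 | (i + j <= 2)%N)
    (-1) ^+ (i + j) * e i j * 'C((r + i).-1, i)%:Z * 'C((s + j).-1, j)%:Z =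
  e 1%N 1%N * r%:Z * s%:Z + e 2 0%N * 'C(r.+1, 2)%:Z + e 0%N 2 * 'C(s.+1, 2)%:Z
    - e 1%N 0%N * r%:Z - e 0%N 1%N * s%:Z + e 0%N 0%N.
Proof.
under eq_bigr do rewrite big_mkcond /=.
rewrite !big_ord_recl !big_ord0 /= /bump /= !addn0 !bin0 !addn1 !addn2 /= !bin1.
rewrite ?addn0 ?add0n /=; ring.
Qed.

Lemma bihilbert_coef_eq I J (e : nat) (al be c1 c2 c0 : int) N :
    (forall r s, (N <= r)%N -> (N <= s)%N ->
       colength (ideal_exp2 I J r s) = (mixed_quadratic e al be c1 c2 c0 r s)%:E) ->
  bihilbert_coef I J 1 0 = c1 /\ bihilbert_coef I J 0 1 = c2.
Proof.
move=> h; rewrite /bihilbert_coef; case: xgetP => [f _ [N' hf]|].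
  apply: (@mixed_quadratic_inj (f 1 1)%N e (f 2 0)%N al (f 0 2)%N be _ _ _ _
            (f 0 0)%N c0 (maxn N N')).
  move=> r s; rewrite !geq_max => /andP[Nr N'r] /andP[Ns N's].
  have [] := etrans (esym (hf r s N'r N's)) (h r s Nr Ns).
  by rewrite bihilbert_sumE.
pose f i j := nth 0 (nth [::] [:: [:: c0; c2; be]; [:: c1; e%:Z]; [:: al]] i) j.
by move/(_ f) => []; exists N => r s Nr Ns; rewrite bihilbert_sumE h.
Qed.

End HilbertCoefficients.

Lemma eventual_value_eq u N l : (forall n, (N <= n)%N -> u n = l) -> eventual_value u = l.
Proof.
move=> h; rewrite /eventual_value; case: xgetP => [x _ [N' hx]|/(_ l)[]]; last by exists N.
by rewrite -(hx (maxn N N')) ?leq_maxr // h // leq_maxl.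
Qed.

Lemma eventual_value_fin u l : eventual_value u = l%:E ->
  exists N, forall n, (N <= n)%N -> u n = l%:E.
Proof. by rewrite /eventual_value; case: xgetP => [x _ [N hx] <-|//]; exists N. Qed.

(** * The main theorem *)

Section ReesJointReductions.
Context {R : comNzRingType} (m I J : set R) (a b : R).
Hypotheses (R_noetherian : noetherian R) (R_local : local_ring m)
  (CM : cohen_macaulay m) (dim2 : krull_dim R 2).

Lemma m_primary_m_open : m_primary m I -> m_open m I.
Proof. by case=> -[iI _ _] rI; split=> //; rewrite rI. Qed.

Lemma m_primary_sub : m_primary m I -> I `<=` m.
Proof. by case=> _ <- x Ix; exists 1%N. Qed.

(** The reduction equation puts [I^(N+1) J^(N+1)] inside [(a, b)]. *)
Lemma joint_reduction_m_open : m_open m I -> m_open m J -> joint_reduction I J a b ->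
  m_open m (ideal2 a b).
Proof.
move=> cI cJ [Ia Jb [N hN]].
apply: m_open_sub (m_open_mono N.+1 N.+1 cI cJ); first exact: ideal2_ideal.
have := hN N N (leqnn _) (leqnn _); rewrite -[N%:Z + 1]PoszD addn1 !ideal_exp2E => ->.
apply: ideal_add_sub; first exact: ideal2_ideal.
  by move=> _ [z _ <-]; apply/ideal2P; exists z, 0; ring.
by move=> _ [z _ <-]; apply/ideal2P; exists 0, z; ring.
Qed.

Lemma length_M1E r s n :
  ideal_len (mono_ideal I J r.+1 s.+1) (M1_denom I J a b r s) n <->
  length_M1 I J a b r s = n%:Z%:E.
Proof.
rewrite /length_M1 -[r%:Z + 1]PoszD -[s%:Z + 1]PoszD !addn1; exact: haslenP.
Qed.

Lemma joint_reduction_M1 : joint_reduction I J a b ->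
  exists N, forall r s, (N <= r)%N -> (N <= s)%N -> length_M1 I J a b r s = 0%E.
Proof.
move=> [Ia Jb [N hN]]; exists N => r s Nr Ns; rewrite /length_M1 -hN //.
by apply/(haslenP _ _ 0)/(@haslen0 R R^o) => //; exact: ideal_exp2_ideal.
Qed.

(** The Rees condition yields [a z = a w] with [w] in [I^r J^s], and [a] can be cancelled by Koszul
    exactness. *)
Lemma rees_colon : m b -> koszul_exact a b ->
    (exists N, forall r s, (N <= r)%N ->
       elt_mul a setT `&` ideal_exp2 I J r%:Z s%:Z =
       elt_mul a (ideal_exp2 I J (r%:Z - 1) s%:Z)) ->
  exists N, forall r s, (N <= r)%N ->
    colon (mono_ideal I J r.+1 s) [set a] `<=` mono_ideal I J r s.
Proof.
move=> mb ab [N hN]; exists N => r s Nr z /(_ a erefl) hz.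
have := hN r.+1 s (leqW Nr); rewrite (_ : r.+1%:Z - 1 = r%:Z); last by lia.
rewrite !ideal_exp2E => /seteqP[/(_ (a * z))h _].
have [|w hw e] := h; first by split; [exists z|rewrite mulrC].
suff -> : z = w by [].
apply/eqP; rewrite -subr_eq0; apply/eqP.
apply: (koszul_exact_regular R_noetherian R_local mb ab).
by rewrite mulrBr e subrr.
Qed.

End ReesJointReductions.

Lemma eventually_forall_ltn (P : nat -> nat -> Prop) k :
  (forall i, exists N, forall n, (N <= n)%N -> P i n) ->
  exists N, forall i n, (i < k)%N -> (N <= n)%N -> P i n.
Proof.
move=> /choice[f hf]; exists (\max_(i < k) f i) => i n ik Nn.
apply: hf; apply: leq_trans Nn; exact: (@leq_bigmax _ (fun i : 'I_k => f i) (Ordinal ik)).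
Qed.

Theorem corollary4p4 (R : comNzRingType) (m I J : set R) (a b : R)
    (R_noetherian : noetherian R) (R_local : local_ring m)
    (R_CM : cohen_macaulay m) (R_dim : krull_dim R 2)
    (R_residue : infinite_residue_field m)
    (I_primary : m_primary m I) (J_primary : m_primary m J)
    (ab_rees : rees_joint_reduction I J a b) :
  let cond_a : Prop := (length_H2 I J a b (0%R, 0%R) < +oo)%E in
  let cond_b : Prop := bihilbert_coef I J 1 0 = hilbert_coef I 1 /\
                       bihilbert_coef I J 0 1 = hilbert_coef J 1 in
  let cond_c : Prop := (forall i : nat, M1_row I J a b i = 0%E) /\
                       (forall j : nat, M1_col I J a b j = 0%E) in
  [<-> cond_a; cond_b; cond_c] /\
  (cond_a \/ cond_b \/ cond_c ->
   length_H2 I J a b (0, 0) =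
   (- hilbert_coef (ideal_mul I J) 2 + hilbert_coef I 2 + hilbert_coef J 2)%:E).
Proof.
move=> cond_a cond_b cond_c.
have cI := m_primary_m_open I_primary; have cJ := m_primary_m_open J_primary.
have [jr reesA reesB] := ab_rees; have [Ia Jb _] := jr.
have ma := m_primary_sub I_primary Ia; have mb := m_primary_sub J_primary Jb.
have cab := joint_reduction_m_open cI cJ jr.
have cba : m_open m (ideal2 b a) by rewrite ideal2C.
have [Na colA] := rees_colon R_noetherian R_local mb
  (m_open_koszul_exact R_CM R_dim cab) reesA.
(* Exchanging [I] and [J] lets the lemmas stated for [a] serve for [b]. *)
have {}reesB : exists N, forall r s, (N <= r)%N ->
    elt_mul b setT `&` ideal_exp2 J I r%:Z s%:Z = elt_mul b (ideal_exp2 J I (r%:Z - 1) s%:Z).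
  by have [N hN] := reesB; exists N => r s Nr; rewrite !(ideal_exp2C J I); apply: hN.
have [Nb colB] := rees_colon R_noetherian R_local ma
  (m_open_koszul_exact R_CM R_dim cba) reesB.
have [al [N1 diffI]] := mixed_len_diff2 R_noetherian R_local R_CM R_dim R_residue
  cI cJ Ia Jb mb cab colA.
have [be [N2 diffJ]] := mixed_len_diff2 R_noetherian R_local R_CM R_dim R_residue
  cJ cI Jb Ia ma cba colB.
have [N3 M1_0] := joint_reduction_M1 jr.
pose N := (Na + Nb + N1 + N2 + N3)%N.
pose e := len (ideal2 a b); pose v r s := (mixed_len I J r s)%:Z.
have colenE r s : colength (mono_ideal I J r s) = (v r s)%:E.
  by apply/haslenP; apply: (lenP R_noetherian R_local); apply: m_open_mono.
(* [mu (r, s)] is the length of [M^1_(r,s)] once [r] or [s] reaches [N]; elsewhere its value is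
   unspecified. *)
have /choice[mu mu_prop] : forall rs : nat * nat, exists n : nat,
    (N <= rs.1)%N || (N <= rs.2)%N ->
    length_M1 I J a b rs.1 rs.2 = n%:Z%:E /\
    n%:Z + v rs.1.+1 rs.2.+1 + v rs.1 rs.2 = e%:Z + v rs.1.+1 rs.2 + v rs.1 rs.2.+1.
  move=> [r s] /=; case: (boolP (_ || _)) => [Nrs|_]; last by exists 0%N.
  have [|n /length_M1E hn en] :=
    haslen_M1 R_noetherian R_local R_CM R_dim (r := r) (s := s) cI cJ Ia Jb cab.
    case/orP: Nrs => Nrs; [left; apply: colA|right]; first by rewrite /N in Nrs; lia.
    by rewrite !(mono_idealC I); apply: colB; rewrite /N in Nrs; lia.
  by exists n => _; split=> //; rewrite /v /e; lia.
have muE r s : (N <= r)%N || (N <= s)%N -> length_M1 I J a b r s = (mu (r, s))%:Z%:E.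
  by move=> /(mu_prop (r, s))[].
have mu_diff r s : (N <= r)%N || (N <= s)%N ->
    (mu (r, s))%:Z + v r.+1 s.+1 + v r s = e%:Z + v r.+1 s + v r s.+1.
  by move=> /(mu_prop (r, s))[].
have mu0 r s : (N <= r)%N -> (N <= s)%N -> mu (r, s) = 0%N.
  move=> Nr Ns; have := muE r s; rewrite Nr => /(_ isT).
  by rewrite M1_0; [case|rewrite /N in Nr; lia|rewrite /N in Ns; lia].
have diff_r r s : (N <= r)%N -> v r.+2 s + v r s = v r.+1 s *+ 2 + al%:Z.
  by move=> Nr; have := diffI r s; rewrite /v /N in Nr *; lia.
have diff_s r s : (N <= s)%N -> v r s.+2 + v r s = v r s.+1 *+ 2 + be%:Z.
  by move=> Ns; have := diffJ s r; rewrite /v !(mixed_lenC J) /N in Ns *; lia.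
have diff_rs r s : (N <= r)%N -> (N <= s)%N ->
    v r.+1 s.+1 + v r s = e%:Z + v r.+1 s + v r s.+1.
  by move=> Nr Ns; rewrite -mu_diff ?Nr // mu0 // add0r.
have [c1 [c2 [c0 vE]]] := mixed_quadratic_of_diff2 (e := e)
  (fun r => @diff_r r N) (@diff_s N) diff_rs.
have [p1 [p2 vIE]] := quadratic_of_diff2 (f := v^~ 0%N) (fun r => @diff_r r 0%N).
have [q1 [q2 vJE]] := quadratic_of_diff2 (f := v 0%N) (@diff_s 0%N).
have [Ie1 Ie2] : hilbert_coef I 1 = p1 /\ hilbert_coef I 2 = p2.
  apply: (hilbert_coef_eq (p0 := al) (N := N)) => n Nn.
  by rewrite -(mono_ideal0l I J) colenE vIE.
have [Je1 Je2] : hilbert_coef J 1 = q1 /\ hilbert_coef J 2 = q2.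
  apply: (hilbert_coef_eq (p0 := be) (N := N)) => n Nn.
  by rewrite -(mono_ideal0r I J) colenE vJE.
(* On the diagonal [e n^2 = 2 e C(n+1, 2) - e n], so the constant term [c0] is unchanged and equals
   [e_2(IJ)]. *)
have [_ IJe2] : hilbert_coef (ideal_mul I J) 1 = c1 + c2 + e%:Z /\
                hilbert_coef (ideal_mul I J) 2 = c0.
  apply: (@hilbert_coef_eq R (ideal_mul I J) (al%:Z + be%:Z + 2 * e%:Z) _ _ N) => n Nn.
  rewrite ideal_exp_mul colenE vE // /mixed_quadratic; congr EFin.
  by have -> : e%:Z * n%:Z * n%:Z = e%:Z * (2 * 'C(n.+1, 2)%:Z - n%:Z);
    [rewrite -mulrA bin2_square|ring].
have [IJe10 IJe01] : bihilbert_coef I J 1 0 = c1 /\ bihilbert_coef I J 0 1 = c2.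
  apply: (bihilbert_coef_eq (e := e) (al := al) (be := be) (c0 := c0) (N := N)).
  by move=> r s Nr Ns; rewrite ideal_exp2E colenE vE.
(* After telescoping, the first differences in [s] of [v N] and [v 0] share the term [be (s + 1)],
   and [e N] cancels; only the linear coefficients remain. *)
have row_sum s : (N <= s)%N -> (\sum_(i < N) mu (val i, s))%N%:Z = c2 - q1.
  move=> Ns; rewrite (@sum_mixed_diff v (fun i => mu (i, s)) e N s); last first.
    by move=> i _; rewrite mu_diff ?Ns ?orbT.
  rewrite (vE N s) // (vE N s.+1) ?leqW // !vJE ?leqW // /mixed_quadratic bin2Z intS; ring.
have col_sum r : (N <= r)%N -> (\sum_(j < N) mu (r, val j))%N%:Z = c1 - p1.
  move=> Nr; rewrite (@sum_mixed_diff (fun s r => v r s) (fun j => mu (r, j)) e N r);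
    last first.
    by move=> j _; rewrite mu_diff ?Nr // -!addrA; congr (_ + _); rewrite addrC.
  rewrite (vE r N) // (vE r.+1 N) ?leqW // !vIE ?leqW // /mixed_quadratic bin2Z intS; ring.
have /choice[g g_prop] k :=
  (fun h => let: ex_intro2 g hg eg := h in ex_intro
     (fun g => ideal_len (mono_ideal I J k k) (power_sum I J a b k) g /\ _) g (conj hg eg))
  (haslen_power_sum R_noetherian R_local R_CM R_dim k cI cJ Ia Jb cab).
(* All terms quadratic in [k] cancel, so the lengths of the stages are affine in [k]. *)
have gE k : (N <= k)%N ->
    (g k)%:Z = (c1 - p1 + (c2 - q1)) * k%:Z + (- c0 + p2 + q2).
  move=> Nk; have [_ /(congr1 Posz)] := g_prop k.
  rewrite !PoszD !PoszM -/(v k k) -/(v k 0%N) -/(v 0%N k) -/e vE // vIE // vJE //.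
  by move=> /(canRL (addrK _)) ->; rewrite /mixed_quadratic; ring.
have sat k : (N <= k)%N -> forall c,
    power_sum I J a b k.+1 (a * b * c) -> power_sum I J a b k c.
  move=> Nk c; apply: (power_sum_saturated R_CM R_dim cab) => z hz.
    rewrite -(mono_ideal0l I J); apply: colA; first by rewrite /N in Nk; lia.
    by rewrite mono_ideal0l.
  rewrite -(mono_ideal0l J I); apply: colB; first by rewrite /N in Nk; lia.
  by rewrite mono_ideal0l.
have g_len k (_ : (N <= k)%N) := (g_prop k).1.
have H2E : cond_b -> length_H2 I J a b (0, 0) = (- c0 + p2 + q2)%:E.
  rewrite /cond_b IJe10 IJe01 Ie1 Je1 => -[e1 e2].
  have gN k : (N <= k)%N -> (g k)%:Z = - c0 + p2 + q2.
    by move=> Nk; rewrite gE // e1 e2; ring.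
  rewrite -(gN N) //; apply: (length_H2_const Ia Jb sat g_len) => k Nk.
  by apply/eqP; rewrite -eqz_nat gN // gN.
have ab : cond_a -> cond_b.
  move=> /(length_H2_finite Ia Jb sat g_len)[n hn].
  rewrite /cond_b IJe10 IJe01 Ie1 Je1.
  have c1p1 : 0 <= c1 - p1 by rewrite -(col_sum N).
  have c2q1 : 0 <= c2 - q1 by rewrite -(row_sum N).
  suff : c1 - p1 + (c2 - q1) <= 0 by lia.
  (* The slope is a nonnegative sum of lengths. If it were at least 1, then [g] at [N + n + t + 1],
     with [t] the absolute value of the constant term, would exceed the bound [n]. *)
  rewrite leNgt; apply/negP => pos; pose t := absz (- c0 + p2 + q2).
  have Nk : (N <= (N + n + t).+1)%N by lia.
  have := hn _ Nk; rewrite -lez_nat gE //.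
  have : (N + n + t).+1%:Z <= (c1 - p1 + (c2 - q1)) * (N + n + t).+1%:Z.
    by rewrite ler_peMl //; lia.
  by rewrite /t; lia.
have bc : cond_b -> cond_c.
  rewrite /cond_b IJe10 IJe01 Ie1 Je1 => -[e1 e2].
  split=> k; apply: (eventual_value_eq (N := N)) => n Nn; rewrite muE ?Nn ?orbT //.
    have [Nk|kN] := leqP N k; first by rewrite mu0.
    have /eqP := row_sum n Nn; rewrite e2 subrr eqz_nat sum_nat_eq0 => /forallP.
    by move=> /(_ (Ordinal kN))/eqP ->.
  have [Nk|kN] := leqP N k; first by rewrite mu0.
  have /eqP := col_sum n Nn; rewrite e1 subrr eqz_nat sum_nat_eq0 => /forallP.
  by move=> /(_ (Ordinal kN))/eqP ->.
have cb : cond_c -> cond_b.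
  move=> [rows cols]; rewrite /cond_b IJe10 IJe01 Ie1 Je1.
  (* The default of [eventual_value] is [+oo], so a value [0] means genuine eventual vanishing. Only
     the rows and columns of index below [N] enter the sums, so one threshold serves them all. *)
  have [S1 hS1] := eventually_forall_ltn N (fun i => eventual_value_fin (rows i)).
  have [S2 hS2] := eventually_forall_ltn N (fun j => eventual_value_fin (cols j)).
  split; apply/eqP; rewrite -subr_eq0.
    rewrite -(col_sum (maxn N S2)) ?leq_maxl // eqz_nat sum_nat_eq0; apply/forallP => j.
    have := hS2 j (maxn N S2) (ltn_ord j) (leq_maxr _ _).
    by rewrite muE ?leq_maxl // => -[->].
  rewrite -(row_sum (maxn N S1)) ?leq_maxl // eqz_nat sum_nat_eq0; apply/forallP => i.
  have := hS1 i (maxn N S1) (ltn_ord i) (leq_maxr _ _).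
  by rewrite muE ?leq_maxl ?orbT // => -[->].
have ba : cond_b -> cond_a by move=> /H2E; rewrite /cond_a => ->; rewrite ltry.
split; first by tfae=> [/ab|/bc|/cb/ba].
have H2 : cond_b -> length_H2 I J a b (0, 0) =
    (- hilbert_coef (ideal_mul I J) 2 + hilbert_coef I 2 + hilbert_coef J 2)%:E.
  by rewrite IJe2 Ie2 Je2.
by case=> [/ab|[|/cb]].
Qed.
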